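(* Let $H$ and $G$ be finitely generated residually finite groups and let $\Gamma = H\rtimes G$ be a semidirect product (with $H$ normal in $\Gamma$ and $G$ acting on $H$). Suppose that $G$ is amenable, and that there is a nested sequence $\{N_i\}$ of finite index characteristic subgroups of $H$ with $\bigcap_i N_i = 1$ such that the box space $\Box_{\{N_i\}}H$ embeds coarsely into Hilbert space. Then $\Gamma$ has a box space which embeds coarsely into Hilbert space; that is, there is a nested sequence $\{K_i\}$ of finite index normal subgroups of $\Gamma$ with trivial intersection such that $\Box_{\{K_i\}}\Gamma$ embeds coarsely into Hilbert space.
   Context: Coarse embedding: a metric space $(X,d_X)$ embeds coarsely in $(Y,d_Y)$ if there are a map $F:X\to Y$ and non-decreasing functions $\rho_\pm:\mathbb{R}_+\to\mathbb{R}_+$ with $\lim_{t\to\infty}\rho_\pm(t)=\infty$ and $\rho_-(d_X(x,x'))\le d_Y(F(x),F(x'))\le \rho_+(d_X(x,x'))$ for all $x,x'\in X$. Box space: let $\Gamma$ be a finitely generated residually finite group with a fixed finite generating set, and $\{K_i\}$ a nested sequence ($K_1\supseteq K_2\supseteq\cdots$) of finite index normal subgroups with trivial intersection. The box space $\Box_{\{K_i\}}\Gamma$ is the disjoint union $\sqcup_i \Gamma/K_i$, where each $\Gamma/K_i$ carries the word metric $d_i$ given by the image of the generating set of $\Gamma$, the distance $d(e_i,e_{i+1})$ between the identity elements $e_i\in\Gamma/K_i$ and $e_{i+1}\in \Gamma/K_{i+1}$ is chosen greater than the maximum of the diameters of $\Gamma/K_i$ and $\Gamma/K_{i+1}$,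 and for $\alpha\in\Gamma/K_i$, $\beta\in\Gamma/K_j$ with $i<j$ one sets $d(\alpha,\beta)=d_i(\alpha,e_i)+\sum_{k=i}^{j-1}d(e_k,e_{k+1})+d_j(e_j,\beta)$. *)

(* Defs.v *)
From HB Require Import structures.
From mathcomp Require Import all_boot all_order all_algebra.
From mathcomp Require Import finmap.
From mathcomp Require Import all_classical all_reals all_analysis.
Set Implicit Arguments.
Unset Strict Implicit.
Unset Printing Implicit Defensive.
Import Order.TTheory GRing.Theory Num.Theory.
Import numFieldNormedType.Exports.
Local Open Scope classical_set_scope.
Local Open Scope ring_scope.

HB.mixin Record isConjClosed (G : groupType) (S : {pred G}) := {
  gpredJ : forall x y : G, x \in S -> (x ^ y)%g \in S
}.

#[short(type="normalClosed")]
HB.structure Definition NormalClosed (G : groupType) :=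
  {S of GroupClosed G S & isConjClosed G S}.

Section Quotient.
Local Open Scope group_scope.
Local Open Scope quotient_scope.
Variables (G : groupType) (N : normalClosed G).

Definition coset_rel : rel G := fun x y => x^-1 * y \in N.

Fact coset_rel_equiv : equiv_class_of coset_rel.
Proof.
split=> [x|x y|y x z]; rewrite /coset_rel.
- by rewrite mulVg gpred1.
- by apply/idP/idP => /gpredVr; rewrite invgM invgK.
- by move=> xy yz; rewrite -(mulgK y x^-1) -mulgA gpredM.
Qed.

Canonical coset_equiv := EquivRelPack coset_rel_equiv.

Definition quotg := {eq_quot coset_equiv}.

HB.instance Definition _ := Choice.on quotg.
HB.instance Definition _ := EqQuotient.on quotg.

Definition quotg_mul := lift_op2 quotg (fun x y : G => x * y).
Definition quotg_inv := lift_op1 quotg (fun x : G => x^-1).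
Definition quotg_one : quotg := lift_cst quotg 1.

Fact pi_quotg_mul : {morph \pi_quotg : x y / x * y >-> quotg_mul x y}.
Proof.
move=> x y; unlock quotg_mul; apply/eqP; rewrite eqmodE /= /coset_rel.
have : x^-1 * repr (\pi_quotg x) \in N.
  by rewrite -[_ \in N]/(coset_equiv _ _) -eqmodE reprK.
have : y^-1 * repr (\pi_quotg y) \in N.
  by rewrite -[_ \in N]/(coset_equiv _ _) -eqmodE reprK.
move: (repr _) (repr _) => x' y' yN xN.
have -> : (x * y)^-1 * (x' * y') = (x^-1 * x') ^ y * (y^-1 * y').
  by rewrite /conjg invgM !mulgA mulgK.
by rewrite gpredM // gpredJ.
Qed.

Fact pi_quotg_inv : {morph \pi_quotg : x / x^-1 >-> quotg_inv x}.
Proof.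
move=> x; unlock quotg_inv; apply/eqP; rewrite eqmodE /= /coset_rel.
have : x^-1 * repr (\pi_quotg x) \in N.
  by rewrite -[_ \in N]/(coset_equiv _ _) -eqmodE reprK.
move: (repr _) => x' xN.
have -> : x^-1^-1 * x'^-1 = ((x^-1 * x')^-1) ^ x^-1.
  by rewrite /conjg !invgM !invgK !mulgA mulgK.
by rewrite gpredJ // gpredVr.
Qed.

Fact pi_quotg_one : \pi_quotg 1 = quotg_one.
Proof. by unlock quotg_one. Qed.

Fact quotg_mulA : associative quotg_mul.
Proof.
move=> x y z; rewrite -[x]reprK -[y]reprK -[z]reprK.
by rewrite -!pi_quotg_mul mulgA.
Qed.

Fact quotg_mul1g : left_id quotg_one quotg_mul.
Proof. by move=> x; rewrite -[x]reprK -pi_quotg_one -pi_quotg_mul mul1g. Qed.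

Fact quotg_mulg1 : right_id quotg_one quotg_mul.
Proof. by move=> x; rewrite -[x]reprK -pi_quotg_one -pi_quotg_mul mulg1. Qed.

Fact quotg_mulVg : left_inverse quotg_one quotg_inv quotg_mul.
Proof.
by move=> x; rewrite -[x]reprK -pi_quotg_inv -pi_quotg_mul mulVg pi_quotg_one.
Qed.

Fact quotg_mulgV : right_inverse quotg_one quotg_inv quotg_mul.
Proof.
by move=> x; rewrite -[x]reprK -pi_quotg_inv -pi_quotg_mul mulgV pi_quotg_one.
Qed.

HB.instance Definition _ := isGroup.Build quotg
  quotg_mulA quotg_mul1g quotg_mulg1 quotg_mulVg quotg_mulgV.

Definition projg (x : G) : quotg := \pi_quotg x.

End Quotient.

Arguments projg {G} N x.

Section SemidirectProduct.
Local Open Scope group_scope.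
Variables G H : groupType.

(* The axioms make every [gact g] bijective, so this is a homomorphism from G
   to the automorphism group of H. *)
Record group_action := GroupAction {
  gact :> G -> {multiplicative H -> H};
  gact1 : forall h, gact 1 h = h;
  gactM : forall g g' h, gact (g * g') h = gact g (gact g' h)
}.

(* H is the normal factor; an alias is needed because H * G already carries
   the direct product structure. *)
Definition sdprod (phi : group_action) : Type := (H * G)%type.

Variable phi : group_action.

HB.instance Definition _ := Choice.copy (sdprod phi) (H * G)%type.

Definition sdprod_mul (x y : sdprod phi) : sdprod phi :=
  (x.1 * phi x.2 y.1, x.2 * y.2).
Definition sdprod_one : sdprod phi := (1, 1).
Definition sdprod_inv (x : sdprod phi) : sdprod phi :=
  (phi x.2^-1 x.1^-1, x.2^-1).

Fact gact_one g : phi g 1 = 1.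
Proof. by apply: (mulgI (phi g 1)); rewrite -gmulfM !mulg1. Qed.

Fact sdprod_mulA : associative sdprod_mul.
Proof.
by move=> x y z; rewrite /sdprod_mul /= gmulfM gactM !mulgA.
Qed.

Fact sdprod_mul1g : left_id sdprod_one sdprod_mul.
Proof. by case=> h g; rewrite /sdprod_mul /= gact1 !mul1g. Qed.

Fact sdprod_mulg1 : right_id sdprod_one sdprod_mul.
Proof. by case=> h g; rewrite /sdprod_mul /= gact_one !mulg1. Qed.

Fact sdprod_mulVg : left_inverse sdprod_one sdprod_inv sdprod_mul.
Proof.
by case=> h g; rewrite /sdprod_mul /= -gmulfM !mulVg gact_one.
Qed.

Fact sdprod_mulgV : right_inverse sdprod_one sdprod_inv sdprod_mul.
Proof.
by case=> h g; rewrite /sdprod_mul /= -gactM !mulgV gact1 mulgV.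
Qed.

HB.instance Definition _ := isGroup.Build (sdprod phi)
  sdprod_mulA sdprod_mul1g sdprod_mulg1 sdprod_mulVg sdprod_mulgV.

End SemidirectProduct.

Section GroupNotions.
Variable G : groupType.

Definition word (S : set G) (w : seq G) : Prop :=
  {in w, forall x, S x \/ S (x^-1)%g}.

Definition generates (S : set G) : Prop :=
  forall g, exists2 w, word S w & g = (\prod_(x <- w) x)%g.

Definition finitely_generated : Prop := exists2 S, finite_set S & generates S.

Definition finite_index (N : normalClosed G) : Prop :=
  finite_set [set: quotg N].

Definition residually_finite : Prop :=
  forall g : G, g != 1%g ->
    exists2 N : normalClosed G, finite_index N & g \notin N.

Definition characteristic (N : {pred G}) : Prop :=
  forall f : {multiplicative G -> G}, bijective f ->
    f @` [set` N] = [set` N].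

(* The left-invariant word metric: the length of a shortest word representing
   x^-1 y. *)
Definition word_dist (R : realType) (S : set G) (x y : G) : R :=
  inf [set (size w)%:R | w in
        [set w | word S w /\ (x * \prod_(z <- w) z)%g = y]].

Definition diameter (R : realType) (S : set G) : R :=
  sup [set word_dist R S x y | x in [set: G] & y in [set: G]].

End GroupNotions.

(* Følner's condition. *)
Definition amenable (R : realType) (G : groupType) : Prop :=
  forall (E : {fset G}) (eps : R), 0 < eps ->
    exists2 F : {fset G}, F != fset0 &
      {in E, forall s, let sF := [fset (s * x)%g | x in F]%fset in
        #|` ((sF `\` F) `|` (F `\` sF))%fset|%:R <= eps * #|` F|%:R}.

Section BoxSpace.
Variables (R : realType) (G : groupType) (S : set G).
Variable (K : nat -> normalClosed G).

Definition box_sequence : Prop :=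
  [/\ forall i, finite_index (K i),
      forall i, {subset K i.+1 <= K i} &
      \bigcap_i [set` K i] = [set 1%g]].

Definition box_space : Type := {i : nat & quotg (K i)}.

Definition quot_gens i : set (quotg (K i)) := projg (K i) @` S.

(* [delta i] is the distance between the identities of G / K i and
   G / K i.+1. *)
Definition box_gaps (delta : nat -> R) : Prop :=
  forall i, Num.max (diameter R (@quot_gens i)) (diameter R (@quot_gens i.+1))
            < delta i.

(* In the first branch [tagged_as a b] is b, cast to the component of a. *)
Definition box_dist (delta : nat -> R) (a b : box_space) : R :=
  let: i := tag a in let: j := tag b in
  if i == j then word_dist R (@quot_gens i) (tagged a) (tagged_as a b)
  else word_dist R (@quot_gens i) (tagged a) 1%g
       + \sum_(minn i j <= k < maxn i j) delta k
       + word_dist R (@quot_gens j) 1%g (tagged b).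

End BoxSpace.

Arguments quot_gens {G} S K i.
Arguments box_gaps {R G} S K delta.
Arguments box_dist {R G} S K delta a b.

Section CoarseEmbedding.
Variable R : realType.

(* Real Hilbert spaces, of arbitrary dimension. *)
Record hilbertSpace := HilbertSpace {
  hilbert_sort :> completeNormedModType R;
  hilbert_dot : {dot hilbert_sort for idfun};
  hilbert_normE : forall x : hilbert_sort, `|x| ^+ 2 = hilbert_dot x x
}.

(* A control function [0, +oo[ -> [0, +oo[; its values at negative reals are
   irrelevant. *)
Definition control (rho : R -> R) : Prop :=
  [/\ forall t, 0 <= t -> 0 <= rho t,
      forall s t, 0 <= s -> s <= t -> rho s <= rho t &
      rho t @[t --> +oo] --> +oo].

Definition coarse_embedding (X Y : Type) (dX : X -> X -> R) (dY : Y -> Y -> R)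
    (F : X -> Y) : Prop :=
  exists rho_ rho' : R -> R, [/\ control rho_, control rho' &
    forall x x', rho_ (dX x x') <= dY (F x) (F x') <= rho' (dX x x')].

Definition embeds_coarsely_in_Hilbert (X : Type) (dX : X -> X -> R) : Prop :=
  exists (V : hilbertSpace) (F : X -> V),
    coarse_embedding dX (fun u v : V => `|u - v|) F.

End CoarseEmbedding.

(* Main.v *)
Require Import Defs.
From HB Require Import structures.
From mathcomp Require Import all_boot all_order all_algebra.
From mathcomp Require Import finmap.
From mathcomp Require Import all_classical all_reals all_analysis.
From mathcomp Require Import ring lra zify.
Set Implicit Arguments.
Unset Strict Implicit.
Unset Printing Implicit Defensive.
Import Order.TTheory GRing.Theory Num.Theory.
Import numFieldNormedType.Exports.
Local Open Scope classical_set_scope.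
Local Open Scope ring_scope.

(** A coarse embedding of a box space is the same thing as a family of
    embeddings of the finite quotients that is controlled uniformly, in
    terms of finite subsets of the group: points that differ by an element
    of a given finite set stay within a bounded distance, and points at
    bounded distance differ by an element of some finite set
    ([coarse_kernels]). One direction is restriction
    ([embeds_coarse_kernels]). For the other ([coarse_kernels_embeds]) the
    quotients are placed along a line at the positions dictated by the gaps;
    as gaps exceed diameters, distances between different quotients are
    comparable to differences of positions.

    The subgroups are [K i], the extension of [N i] by a finite index
    subgroup [M i] of [G] acting trivially on the finite quotient of [H] by
    [N i]. Such subgroups exist because [N i] is characteristic and of
    finite index, and residual finiteness of [G] lets them shrink to the
    identity ([semidirect_box_sequence]).

    Write a point of the quotient by [K i] as [(h, q)]. Since [G] is
    amenable, one wants to average the embedding of the quotient of [H] over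
    a Følner set [A]: to combine, over the cosets [z] of the form [q * a]
    with [a] in [A], the images of [z^-1 * h]. When [q] moves a little, a
    few of the cosets change, and with vectors of unbounded length this
    would be fatal. So the embeddings are first converted to unit vectors,
    nearly constant at a prescribed scale and with inner products at most
    1/2 at large distance ([coarse_localized], [localized_kernels]). Their
    average with weights the square roots of the distribution of [q * a] is
    again of this kind ([localized_semidirect]): for nearby points the
    weights agree up to the Følner constant, and the displacement in [H]
    seen from a common [z] is one of finitely many; and two points with a
    large inner product have a common [z] from which they look close, hence
    are close. Finally such unit vectors at finer and finer scales are added
    up to uniformly controlled embeddings ([localized_coarse]).

    All quotients are finite, so that only kernels given by finitely many
    real functions occur. Gram-Schmidt on finite sets ([euclidean_hilbert])
    provides them, and Schoenberg's passage from the squared distance [k] to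
    the positive definite kernel [exp (- k)] is replaced by a product of
    rational kernels of finite rank ([gram_cutoff_euclidean]). The target of
    the final embedding is the space [l2] of square-summable sequences, in
    which only finitely supported vectors are used. *)

(** * The Hilbert space of square-summable sequences *)

Section SquareSummable.
Variable R : realType.
Implicit Types x y z : nat -> R.

Definition sqsum x n : R := \sum_(k < n) x k ^+ 2.

(** Bounded partial sums, rather than a convergent series: this is the form
    that survives pointwise limits, hence the one that completeness needs. *)
Definition square_summable : {pred nat -> R} :=
  mem [set x : nat -> R | exists M, forall n, sqsum x n <= M].

Lemma square_summableP x :
  reflect (exists M, forall n, sqsum x n <= M) (x \in square_summable).
Proof. by apply: (iffP idP); rewrite unfold_in /= ?inE //= => /set_mem. Qed.

Lemma series_sqr x n : series (fun k => x k ^+ 2) n = sqsum x n.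
Proof. by rewrite seriesEord. Qed.

Lemma sqsum_cvg x : x \in square_summable -> cvgn (series (fun k => x k ^+ 2)).
Proof.
case/square_summableP => M xM; apply: nondecreasing_is_cvgn.
  by apply/nondecreasing_series => n _ _; exact: sqr_ge0.
by exists M => _ [n _ <-]; rewrite seriesEord; exact: xM.
Qed.

Lemma square_summable_submod : submod_closed square_summable.
Proof.
split.
  by apply/square_summableP; exists 0 => n; rewrite /sqsum big1 // => i _;
    rewrite expr0n.
move=> a x y /square_summableP[M xM] /square_summableP[N yN].
apply/square_summableP; exists (2 * a ^+ 2 * M + 2 * N) => n.
(* (a x + y)^2 <= 2 (a x)^2 + 2 y^2, the difference being (a x - y)^2. *)
apply: (@le_trans _ _ (2 * a ^+ 2 * sqsum x n + 2 * sqsum y n)).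
  rewrite !mulr_sumr -big_split ler_sum // => i _ /=.
  rewrite [X in X ^+ 2](_ : _ = a * x i + y i) //.
  rewrite -subr_ge0 [X in 0 <= X](_ : _ = (a * x i - y i) ^+ 2) ?sqr_ge0 //.
  by ring.
by rewrite lerD ?ler_wpM2l // mulr_ge0 ?sqr_ge0.
Qed.

HB.instance Definition _ :=
  GRing.isSubmodClosed.Build R (nat -> R)
    square_summable square_summable_submod.

Record l2 := L2 { l2val :> nat -> R; l2valP : l2val \in square_summable }.

HB.instance Definition _ := [isSub for l2val].
HB.instance Definition _ := [Choice of l2 by <:].
HB.instance Definition _ := [SubChoice_isSubLmodule of l2 by <:].

Implicit Types u v w : l2.

Lemma l2B u v k : (u - v) k = u k - v k. Proof. by []. Qed.

Definition l2dot u v : R := limn (series (fun k => u k * v k)).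

(** By polarization the series is a combination of three series of squares. *)
Lemma l2dot_cvg u v : cvgn (series (fun k => u k * v k)).
Proof.
rewrite [X in series X](_ : _ = 2^-1 *:
  ((fun k => (u + v) k ^+ 2) - (fun k => u k ^+ 2) - (fun k => v k ^+ 2))).
  apply: is_cvg_seriesZ; apply: is_cvg_seriesB; first apply: is_cvg_seriesB;
  exact/sqsum_cvg/l2valP.
apply/funext => k /=.
rewrite [RHS](_ : _ = 2^-1 * ((u k + v k) ^+ 2 - u k ^+ 2 - v k ^+ 2)) //.
by field.
Qed.

Lemma l2dotC u v : l2dot u v = l2dot v u.
Proof. by congr (limn (series _)); apply/funext => k; rewrite mulrC. Qed.

Lemma l2dotZl a u v : l2dot (a *: u) v = a * l2dot u v.
Proof.
rewrite /l2dot -[RHS](lim_seriesZ a (@l2dot_cvg u v)).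
by congr (limn (series _)); apply/funext => k; rewrite /= -mulrA.
Qed.

Lemma l2dotDl u v w : l2dot (u + v) w = l2dot u w + l2dot v w.
Proof.
rewrite /l2dot -lim_seriesD; [|exact: l2dot_cvg..].
by congr (limn (series _)); apply/funext => k; rewrite /= mulrDl.
Qed.

Lemma l2dot_ge_sqsum u n : sqsum u n <= l2dot u u.
Proof.
rewrite -series_sqr.
apply: nondecreasing_cvgn_le; last exact/sqsum_cvg/l2valP.
by apply/nondecreasing_series => *; exact: sqr_ge0.
Qed.

Lemma l2dot_le u M : (forall n, sqsum u n <= M) -> l2dot u u <= M.
Proof.
move=> uM; apply: limr_le; first exact: l2dot_cvg.
by apply: nearW => n; rewrite seriesEord; exact: uM.
Qed.

Lemma sqsum_le x m n : (m <= n)%N -> sqsum x m <= sqsum x n.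
Proof.
move=> mn; rewrite /sqsum -(subnKC mn) big_split_ord /= lerDl.
by apply: sumr_ge0 => i _; exact: sqr_ge0.
Qed.

Lemma l2dot_finite u n : (forall k, (n <= k)%N -> u k = 0) ->
  l2dot u u = sqsum u n.
Proof.
move=> un; apply/eqP; rewrite eq_le l2dot_ge_sqsum andbT; apply: l2dot_le => m.
apply: le_trans (sqsum_le u (leq_maxr n m)) _.
rewrite /sqsum -(subnKC (leq_maxl n m)) big_split_ord /=.
rewrite [X in _ + X]big1 ?addr0 //.
by move=> i _; rewrite un ?leq_addr // expr0n.
Qed.

Lemma l2dot_ge0 u : 0 <= l2dot u u.
Proof. by have := l2dot_ge_sqsum u 0; rewrite /sqsum big_ord0. Qed.

Lemma l2dot_eq0 u : l2dot u u = 0 -> u = 0.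
Proof.
move=> u0; apply/val_inj/funext => k /=; apply/eqP.
rewrite -sqrf_eq0 eq_le sqr_ge0 andbT -u0.
apply: le_trans (l2dot_ge_sqsum u k.+1).
by rewrite /sqsum big_ord_recr /= lerDr sumr_ge0 // => i _; exact: sqr_ge0.
Qed.

Let bilin : bilinear_for *%R *%R l2dot.
Proof.
split=> [v a u w|u a v w] /=; first by rewrite l2dotDl l2dotZl.
by rewrite l2dotC l2dotDl l2dotZl !(l2dotC u).
Qed.
HB.instance Definition _ :=
  bilinear_isBilinear.Build R l2 l2 R *%R (idfun \; *%R) l2dot bilin.

Let herm u v : l2dot u v = (-1) ^+ false * idfun (l2dot v u).
Proof. by rewrite expr0 mul1r l2dotC. Qed.
HB.instance Definition _ :=
  isHermitianSesquilinear.Build R l2 false idfun l2dot herm.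

Let pos u : u != 0 -> 0 < l2dot u u.
Proof.
move=> u0; rewrite lt_neqAle l2dot_ge0 andbT eq_sym.
by apply: contra u0 => /eqP/l2dot_eq0/eqP.
Qed.
HB.instance Definition _ := isDotProduct.Build R l2 l2dot pos.

Definition l2norm u := Num.sqrt (l2dot u u).

Lemma l2norm_sqr u : l2norm u ^+ 2 = l2dot u u.
Proof. by rewrite sqr_sqrtr // l2dot_ge0. Qed.

Let l2normZ a u : l2norm (a *: u) = `|a| * l2norm u.
Proof.
rewrite /l2norm l2dotZl l2dotC l2dotZl mulrA -expr2 sqrtrM ?sqr_ge0 //.
by rewrite sqrtr_sqr.
Qed.

Let l2norm0_eq0 u : l2norm u = 0 -> u = 0.
Proof. by move=> u0; apply: l2dot_eq0; rewrite -l2norm_sqr u0 expr0n. Qed.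

Lemma l2dot_le_norm u v : l2dot u v <= l2norm u * l2norm v.
Proof.
set a := l2norm u; set b := l2norm v; set c := l2dot u v.
have q_ge0 t : 0 <= a ^+ 2 - 2 * t * c + t ^+ 2 * b ^+ 2.
  have := l2dot_ge0 (u - t *: v).
  rewrite -scaleNr l2dotDl !(l2dotC _ (_ + _)) !l2dotDl !l2dotZl.
  rewrite (l2dotC u (- t *: v)) !l2dotZl (l2dotC v (- t *: v)) l2dotZl.
  rewrite (l2dotC v u) /a /b !l2norm_sqr -/c.
  by congr (0 <= _); ring.
have a0 : 0 <= a by exact: sqrtr_ge0.
have b0 : 0 <= b by exact: sqrtr_ge0.
have [/eqP bE|bN] := boolP (b == 0).
  by rewrite bE mulr0 /c (l2norm0_eq0 bE) l2dotC -(scale0r v) l2dotZl mul0r.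
have [/eqP aE|aN] := boolP (a == 0).
  by rewrite aE mul0r /c (l2norm0_eq0 aE) -(scale0r u) l2dotZl mul0r.
(* The discriminant argument, at t = a / b: there the quadratic form takes a
   value of the same sign as a b - c. *)
have := q_ge0 (a / b).
rewrite (_ : _ + _ = 2 * a / b * (a * b - c)); last by field.
rewrite pmulr_rge0 ?subr_ge0 // divr_gt0 ?mulr_gt0 //;
by rewrite lt_neqAle eq_sym ?aN ?bN.
Qed.

Let l2normD u v : l2norm (u + v) <= l2norm u + l2norm v.
Proof.
rewrite -ler_sqr ?nnegrE ?addr_ge0 ?sqrtr_ge0 //.
rewrite l2norm_sqr l2dotDl !(l2dotC _ (_ + _)) !l2dotDl (l2dotC v u) sqrrD.
rewrite -!l2norm_sqr.
have := l2dot_le_norm u v; set d := l2dot u v; lra.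
Qed.

HB.instance Definition _ :=
  Lmodule_isNormed.Build R l2 l2normD l2normZ l2norm0_eq0.

Lemma l2_normE u : `|u| ^+ 2 = l2dot u u. Proof. exact: l2norm_sqr. Qed.

Lemma l2_norm_coord u k : `|u k| <= `|u|.
Proof.
rewrite -ler_sqr ?nnegrE // -normrX ger0_norm ?sqr_ge0 // l2_normE.
apply: le_trans (l2dot_ge_sqsum u k.+1).
by rewrite /sqsum big_ord_recr /= lerDr sumr_ge0 // => i _; exact: sqr_ge0.
Qed.

(** The pointwise limit [l] of a Cauchy filter is its limit: if the ball of
    radius [e] around [v] belongs to the filter, every partial sum of the
    squares of [v - l] is a limit of numbers at most [e ^+ 2]. This gives both
    that [l] is square-summable and that it is close to [v]. *)
Lemma l2_complete (F : set_system l2) : ProperFilter F -> cauchy F -> cvg F.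
Proof.
move=> FF /cauchyP Fcauchy.
have Fcoord k : cvg ((fun u : l2 => u k) @ F).
  apply: R_complete; apply/cauchyP => e e0; have [v Fv] := Fcauchy e e0.
  exists (v k); suff : F [set u : l2 | ball (v k) e (u k)] by [].
  apply: filterS Fv => u /=.
  rewrite -!ball_normE /=; apply: le_lt_trans.
  exact: (l2_norm_coord (v - u)).
pose l k : R := lim ((fun u : l2 => u k) @ F).
have close e : 0 < e -> exists2 v : l2, F (ball v e) &
    forall n, sqsum (fun k => v k - l k) n <= e ^+ 2.
  move=> e0; have [v Fv] := Fcauchy e e0; exists v => // n.
  have cv : (fun u : l2 => sqsum (v - u) n) @ F -->
      sqsum (fun k => v k - l k) n.
    apply: cvg_big => [|k _]; first exact: add_continuous.
    apply: cvgM; apply: cvgB; (exact: cvg_cst || exact: Fcoord).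
  rewrite -(cvg_lim _ cv) //; apply: limr_le.
    by apply/cvg_ex; eexists; exact: cv.
  apply: filterS Fv => u; rewrite -ball_normE /= => uv.
  apply: le_trans (l2dot_ge_sqsum (v - u : l2) n) _.
  by rewrite -l2_normE ler_sqr ?nnegrE ?(ltW uv) ?(ltW e0).
have lP : l \in square_summable.
  have [v _ vl] := close 1 ltr01.
  have dP : (fun k => v k - l k) \in square_summable.
    by apply/square_summableP; exists (1 ^+ 2).
  rewrite [l](_ : _ = (v : nat -> R) - (fun k => v k - l k)); last first.
    by apply/funext => k; rewrite [RHS](_ : _ = v k - (v k - l k)) // subKr.
  by rewrite rpredB // l2valP.
apply/cvg_ex; exists (L2 lP); apply/cvgrPdist_le => e e0.
have [v Fv vl] := close (e / 2) (divr_gt0 e0 (ltr0n _ 2)).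
near=> u; rewrite -(subrKA v) (splitr e).
apply: le_trans (ler_normD _ _) _; apply: lerD.
  have e2 : 0 <= e / 2 by rewrite divr_ge0 ?ltW.
  rewrite distrC -ler_sqr ?nnegrE ?e2 // l2_normE.
  exact: (@l2dot_le (v - L2 lP) _ vl).
have : ball v (e / 2) u by near: u.
by rewrite -ball_normE /= => /ltW.
Unshelve. all: by end_near. Qed.

HB.instance Definition _ := Uniform_isComplete.Build l2 l2_complete.

Definition l2_hilbert : hilbertSpace R := HilbertSpace l2_normE.

End SquareSummable.

(** * Positive definite and Euclidean kernels *)

Section Kernels.
Variables (R : realType) (X : Type).
Implicit Types (k u : X -> X -> R) (c : X -> R).

(** Positive definite kernels of finite rank: the functions [c] are the
    coordinates of a map to some [R^n] of which [u] is the Gram matrix. On a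
    finite set every positive definite kernel has this form, and explicit
    coordinates make closure under products immediate. *)
Definition gram u := exists cs : seq (X -> R),
  forall x y, u x y = \sum_(c <- cs) c x * c y.

(** Squared distances of a map to some [R^n]. *)
Definition euclidean k := exists cs : seq (X -> R),
  forall x y, k x y = \sum_(c <- cs) (c x - c y) ^+ 2.

Lemma gram_rank1 c : gram (fun x y => c x * c y).
Proof. by exists [:: c] => x y; rewrite big_seq1. Qed.

Lemma gramD u1 u2 : gram u1 -> gram u2 -> gram (fun x y => u1 x y + u2 x y).
Proof.
by move=> [s1 s1E] [s2 s2E]; exists (s1 ++ s2) => x y; rewrite big_cat s1E s2E.
Qed.

(** Schur product: the coordinates of a tensor product of vectors are the
    products of their coordinates. *)
Lemma gramM u1 u2 : gram u1 -> gram u2 -> gram (fun x y => u1 x y * u2 x y).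
Proof.
move=> [s1 s1E] [s2 s2E].
exists [seq (fun x => c1 x * c2 x) | c1 <- s1, c2 <- s2] => x y.
rewrite big_allpairs_dep /= s1E s2E big_distrlr /=.
by apply: eq_bigr => c1 _; apply: eq_bigr => c2 _; rewrite mulrACA.
Qed.

Lemma gram_sum (I : Type) (r : seq I) (u : I -> X -> X -> R) :
  (forall i, gram (u i)) -> gram (fun x y => \sum_(i <- r) u i x y).
Proof.
move=> gu; elim: r => [|i r IH].
  by exists [::] => x y; rewrite !big_nil.
case: (gramD (gu i) IH) => s sE; exists s => x y.
by rewrite big_cons -sE.
Qed.

Lemma euclideanD k1 k2 :
  euclidean k1 -> euclidean k2 -> euclidean (fun x y => k1 x y + k2 x y).
Proof.
by move=> [s1 s1E] [s2 s2E]; exists (s1 ++ s2) => x y; rewrite big_cat s1E s2E.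
Qed.

Lemma euclidean_sum (I : Type) (r : seq I) (k : I -> X -> X -> R) :
  (forall i, euclidean (k i)) -> euclidean (fun x y => \sum_(i <- r) k i x y).
Proof.
move=> ek; elim: r => [|i r IH].
  by exists [::] => x y; rewrite !big_nil.
case: (euclideanD (ek i) IH) => s sE; exists s => x y.
by rewrite big_cons -sE.
Qed.

(** If [u] is the Gram matrix of unit vectors, [2 * (1 - u x y)] is the
    squared distance of the vectors at [x] and [y]. *)
Lemma euclidean_gram u : gram u -> (forall x, u x x = 1) ->
  euclidean (fun x y => 2 * (1 - u x y)).
Proof.
move=> [s sE] u1; exists s => x y.
transitivity (u x x + u y y - 2 * u x y); first by rewrite !u1; ring.
rewrite !sE mulr_sumr -big_split -sumrB; apply: eq_bigr => c _ /=; ring.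
Qed.

Lemma euclidean_ge0 k x y : euclidean k -> 0 <= k x y.
Proof. by case=> s ->; apply: sumr_ge0 => c _; exact: sqr_ge0. Qed.

Lemma euclideanC k x y : euclidean k -> k x y = k y x.
Proof.
by case=> s sE; rewrite !sE; apply: eq_bigr => c _; rewrite -opprB sqrrN.
Qed.

(** What the Gaussian [exp (- k)] provides in Schoenberg's argument: a
    positive definite kernel that is close to 1 where [k] is small, and small
    where [k] is large. The bounds are chosen to be stable under sums of the
    [k] and products of the [u], the second through
    [(1 + a) * (1 + b) >= 1 + (a + b)]. *)
Definition gram_cutoff k := exists u,
  [/\ gram u, forall x, u x x = 1, forall x y, 0 <= u x y,
      forall x y, 1 - u x y <= k x y &
      forall x y, u x y * (1 + k x y / 4) <= 1].

Lemma gram_cutoffD k1 k2 : (forall x y, 0 <= k1 x y) ->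
  (forall x y, 0 <= k2 x y) -> gram_cutoff k1 -> gram_cutoff k2 ->
  gram_cutoff (fun x y => k1 x y + k2 x y).
Proof.
move=> k10 k20 [u1 [g1 d1 p1 l1 b1]] [u2 [g2 d2 p2 l2 b2]].
exists (fun x y => u1 x y * u2 x y); split.
- exact: gramM.
- by move=> x; rewrite d1 d2 mulr1.
- by move=> x y; rewrite mulr_ge0.
- move=> x y.
  have le1 (a k : R) : 0 <= a -> 0 <= k -> a * (1 + k / 4) <= 1 -> a <= 1.
    by move=> a0 k0; apply: le_trans; rewrite ler_peMr // lerDl divr_ge0.
  have := le1 _ _ (p1 x y) (k10 x y) (b1 x y).
  have := le1 _ _ (p2 x y) (k20 x y) (b2 x y).
  have := p1 x y; have := l1 x y; have := l2 x y.
  move: (u1 x y) (u2 x y) (k1 x y) (k2 x y) => a b k l bl ak a0 b_1 a_1.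
  have : a * (1 - b) <= 1 - b by rewrite ler_piMl // subr_ge0.
  lra.
- move=> x y.
  have := mulr_ile1 _ _ (b1 x y) (b2 x y).
  rewrite !mulr_ge0 ?addr_ge0 ?divr_ge0 // => /(_ isT isT); apply: le_trans.
  have := p1 x y; have := p2 x y; have := k10 x y; have := k20 x y.
  move: (u1 x y) (u2 x y) (k1 x y) (k2 x y) => a b k l l0 k0 b0 a0.
  rewrite -subr_ge0 [X in 0 <= X](_ : _ = a * b * (k * l) / 16); last by field.
  by rewrite divr_ge0 ?mulr_ge0.
Qed.

(** For a single function with values in [-1, 1], the rational kernel
    [1 - (a - b)^2 / ((1 + a^2) (1 + b^2))] does what the Gaussian
    [exp (- (a - b)^2)] would, and has finite rank: it is the squared cosine
    of the angle between the vectors [(1, a)] and [(1, b)] of the plane. *)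
Lemma gram_cutoff_small c : (forall x, `|c x| <= 1) ->
  gram_cutoff (fun x y => (c x - c y) ^+ 2).
Proof.
move=> c1; pose D x : R := (1 + c x ^+ 2)^-1.
have n0 (a : R) : 1 + a ^+ 2 != 0 by rewrite gt_eqF // ltr_pwDl // sqr_ge0.
exists (fun x y => ((1 + c x * c y) ^+ 2) * (D x * D y)); split.
- have gc := gram_rank1 c.
  have g1 : gram (fun _ _ : X => 1 * 1) := gram_rank1 (fun _ => 1).
  have gd := gram_rank1 D.
  case: (gramM (gramM (gramD g1 gc) (gramD g1 gc)) gd) => s sE.
  by exists s => x y; rewrite -sE mulr1 expr2.
- by move=> x; rewrite /D -expr2 -invfM -expr2 mulfV // sqrf_eq0 n0.
- move=> x y; rewrite mulr_ge0 ?sqr_ge0 // mulr_ge0 // invr_ge0;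
  by rewrite addr_ge0 ?sqr_ge0.
- move=> x y.
  rewrite [X in X <= _](_ : _ = (c x - c y) ^+ 2 * (D x * D y)).
    rewrite ler_piMr ?sqr_ge0 // mulr_ile1 ?invr_ge0 ?addr_ge0 ?sqr_ge0 //;
    by rewrite invf_le1 ?lerDl ?sqr_ge0 // ltr_pwDl // sqr_ge0.
  by rewrite /D; field; rewrite !n0.
- move=> x y; have := n0 (c x); have := n0 (c y).
  have sq z : c z ^+ 2 <= 1.
    by rewrite -[c z ^+ 2]ger0_norm ?sqr_ge0 // normrX exprn_ile1.
  have := sq x; have := sq y; rewrite /D.
  move: (c x) (c y) => a b b1 a1 nb na.
  rewrite -invfM mulrAC ler_pdivrMr ?mul1r; last first.
    by rewrite mulr_gt0 // ltr_pwDl // sqr_ge0.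
  rewrite -subr_ge0.
  (* The last factor is where |a| <= 1 and |b| <= 1 matter. *)
  rewrite (_ : _ - _ = (a - b) ^+ 2 * (1 - (1 + a * b) ^+ 2 / 4)).
    rewrite mulr_ge0 ?sqr_ge0 // subr_ge0 ler_pdivrMr // mul1r.
    by have := sqr_ge0 (a - b); have := sqr_ge0 (a + b); nra.
  by field.
Qed.

End Kernels.

(** Every coordinate of [k] can be replaced by [m] copies of itself divided by
    the square root of [m] without changing [k]; on a finite set, [m] can be
    taken so large that the coordinates have values in [-1, 1]. *)
Lemma gram_cutoff_euclidean (R : realType) (X : eqType) (k : X -> X -> R)
    (e : seq X) t : (forall x, x \in e) ->
  euclidean k -> 0 <= t -> gram_cutoff (fun x y => t * k x y).
Proof.
move=> eT [cs kE] t0.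
have eqst (k1 k2 : X -> X -> R) : (forall x y, k1 x y = k2 x y) ->
    gram_cutoff k1 -> gram_cutoff k2.
  by move=> k12 [u [? ? ? l b]]; exists u; split=> // x y; rewrite -k12.
have st0 : gram_cutoff (fun _ _ : X => 0 : R).
  exists (fun _ _ => 1 * 1).
  split; [exact: (gram_rank1 (fun _ : X => 1 : R))|by move=> *; lra..].
suff st1 (c : X -> R) : gram_cutoff (fun x y => t * (c x - c y) ^+ 2).
  suff : gram_cutoff (fun x y : X => t * \sum_(c <- cs) (c x - c y) ^+ 2).
    by apply: eqst => x y; rewrite kE.
  elim: cs {kE} => [|c cs IH].
    by apply: eqst st0 => x y; rewrite big_nil mulr0.
  apply: eqst (gram_cutoffD _ _ (st1 c) IH) => x y.
  - by rewrite big_cons mulrDr.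
  - by rewrite mulr_ge0 ?sqr_ge0.
  - by rewrite mulr_ge0 // sumr_ge0 // => ? _; rewrite sqr_ge0.
pose M := \sum_(x <- e) `|c x|.
have cM x : `|c x| <= M.
  move: (eT x); rewrite /M; elim: (e) => [|y s IH] //=.
  rewrite inE big_cons => /predU1P[->|/IH xs].
    by rewrite lerDl sumr_ge0.
  by rewrite (le_trans xs) // lerDr.
have M0 : 0 <= M by rewrite sumr_ge0.
pose m := (Num.bound (t * M ^+ 2)).+1.
have m0 : 0 < m%:R :> R by rewrite ltr0n.
have tm0 : 0 <= t / m%:R by rewrite divr_ge0 // ltW.
pose tau := Num.sqrt (t / m%:R).
have small : gram_cutoff (fun x y : X => (tau * c x - tau * c y) ^+ 2).
  apply: (gram_cutoff_small (c := fun x => tau * c x)) => x.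
  rewrite -ler_sqr ?nnegrE // expr1n normrM exprMn (ger0_norm (sqrtr_ge0 _)).
  rewrite sqr_sqrtr // mulrAC ler_pdivrMr // mul1r.
  apply: (@le_trans _ _ (t * M ^+ 2)).
    by rewrite ler_wpM2l // ler_sqr ?nnegrE.
  have := archi_boundP (mulr_ge0 t0 (sqr_ge0 M)); rewrite /m -natr1.
  by set b := (Num.bound _)%:R; lra.
have : gram_cutoff (fun x y : X => m%:R * (tau * c x - tau * c y) ^+ 2).
  elim: (m) => [|j IH]; first by apply: eqst st0 => x y; rewrite mul0r.
  apply: eqst (gram_cutoffD _ _ small IH) => x y.
  - by rewrite -natr1; ring.
  - exact: sqr_ge0.
  - by apply: mulr_ge0; [exact: ler0n|exact: sqr_ge0].
apply: eqst => x y.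
rewrite -mulrBr exprMn sqr_sqrtr // mulrA; congr (_ * _).
by rewrite mulrC divfK // gt_eqF.
Qed.

Lemma gram_comp (R : realType) (X Y : Type) (f : X -> Y) (u : Y -> Y -> R) :
  gram u -> gram (fun x y => u (f x) (f y)).
Proof.
by move=> [s sE]; exists [seq c \o f | c <- s] => x y; rewrite big_map sE.
Qed.

(** * Coordinates for finite subsets of a Hilbert space *)

Section HilbertCoordinates.
Variables (R : realType) (V : hilbertSpace R).

Let dot : V -> V -> R := hilbert_dot V.

Let dotDl x y z : dot (x + y) z = dot x z + dot y z.
Proof. exact: linearDl. Qed.
Let dotZl a x y : dot (a *: x) y = a * dot x y.
Proof. exact: linearZl_LR. Qed.
Let dotC x y : dot x y = dot y x.
Proof. by rewrite /dot hermC expr0 mul1r. Qed.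

Let dotBZ a b x y z : dot (x - a *: z) (y - b *: z) =
  dot x y - b * dot x z - a * dot y z + a * b * dot z z.
Proof.
rewrite -!(scaleNr _ z) !dotDl !dotZl !(dotC _ (y + _)) !dotDl !dotZl.
by rewrite (dotC y x) (dotC z x); ring.
Qed.

(** Gram-Schmidt: the coordinate [c0] along [f a] is split off, and the
    induction proceeds with the projections to the orthogonal complement of
    [f a]. The first clause is what makes the remaining coordinates vanish at
    [a]. When [f a = 0], division by zero yields 0 and nothing is split
    off. *)
Lemma hilbert_gram (X : eqType) (f : X -> V) (s : seq X) :
  exists cs : seq (X -> R),
    (forall x, f x = 0 -> forall y, \sum_(c <- cs) c x * c y = 0) /\
    ({in s &, forall x y, dot (f x) (f y) = \sum_(c <- cs) c x * c y}).
Proof.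
elim: s f => [|a s IH] f.
  by exists [::]; split=> // x _ y; rewrite big_nil.
pose c0 x := dot (f x) (f a) / `|f a|.
have dot0 v : dot 0 v = 0 by rewrite -(scale0r v) dotZl mul0r.
have c0a y : c0 a * c0 y = dot (f a) (f y).
  rewrite /c0; have -> : dot (f a) (f a) = `|f a| ^+ 2 by rewrite hilbert_normE.
  have [fa0|fa0] := eqVneq (f a) 0.
    by rewrite fa0 normr0 invr0 !mulr0 dot0.
  by rewrite (dotC (f y)); field; rewrite normr_eq0.
have [cs [cs0 csE]] := IH (fun x => f x - (c0 x / `|f a|) *: f a).
have faa : f a - (c0 a / `|f a|) *: f a = 0.
  have [->|fa0] := eqVneq (f a) 0; first by rewrite scaler0 subr0.
  rewrite -[X in X - _]scale1r -scalerBl /c0.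
  have -> : dot (f a) (f a) = `|f a| ^+ 2 by rewrite hilbert_normE.
  by rewrite [X in X *: _](_ : _ = 0) ?scale0r //; field; rewrite normr_eq0.
exists (c0 :: cs); split=> [x fx0 y|x y].
  rewrite big_cons /c0 fx0 dot0 !mul0r add0r cs0 // /c0 fx0 dot0 !mul0r.
  by rewrite scale0r subr0.
have sC : forall z w, \sum_(c <- cs) c z * c w = \sum_(c <- cs) c w * c z.
  by move=> z w; apply: eq_bigr => c _; rewrite mulrC.
rewrite big_cons !inE => /predU1P[-> _|xs].
  by rewrite c0a (cs0 a faa) addr0.
move=> /predU1P[->|ys]; first by rewrite mulrC c0a sC (cs0 a faa) addr0 dotC.
rewrite -csE // dotBZ /c0.
have -> : dot (f a) (f a) = `|f a| ^+ 2 by rewrite hilbert_normE.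
have [fa0|fa0] := eqVneq (f a) 0.
  by rewrite fa0 normr0 invr0; ring.
by field; rewrite normr_eq0.
Qed.

Lemma euclidean_hilbert (X : eqType) (f : X -> V) (e : seq X) :
  (forall x, x \in e) -> euclidean (fun x y => `|f x - f y| ^+ 2).
Proof.
move=> eT; have [cs [_ csE]] := hilbert_gram f e; exists cs => x y.
rewrite hilbert_normE -/(dot _ _) -(scale1r (f y)) dotBZ !csE //.
rewrite !mulr_sumr -!sumrN -!big_split /=.
by apply: eq_bigr => c _; ring.
Qed.

End HilbertCoordinates.

(** * Quotient groups and their word metrics *)

Section QuotientGroup.
Local Open Scope group_scope.
Local Open Scope quotient_scope.
Variables (G : groupType) (N : normalClosed G).

Lemma projgM x y : projg N (x * y) = projg N x * projg N y.
Proof. exact: pi_quotg_mul. Qed.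

Lemma projg1 : projg N 1 = 1.
Proof. exact: pi_quotg_one. Qed.

Lemma projgV x : projg N x^-1 = (projg N x)^-1.
Proof. exact: pi_quotg_inv. Qed.

Lemma projgP x y : projg N x = projg N y <-> x^-1 * y \in N.
Proof.
rewrite /projg; split=> [/eqP|xy]; first by rewrite eqmodE.
by apply/eqP; rewrite eqmodE.
Qed.

Lemma projgK (z : quotg N) : projg N (repr z) = z.
Proof. exact: reprK. Qed.

Lemma projg_prod w :
  projg N (\prod_(x <- w) x) = \prod_(x <- map (projg N) w) x.
Proof.
elim: w => [|x w IH]; first by rewrite !big_nil projg1.
by rewrite map_cons !big_cons projgM IH.
Qed.

Lemma finite_index_enum : finite_index N ->
  exists e : seq (quotg N), uniq e /\ forall z, z \in e.
Proof.
move=> /finite_seqP[e eE]; exists (undup e).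
split=> [|z]; first exact: undup_uniq.
by rewrite mem_undup; have : [set: quotg N] z by []; rewrite eE.
Qed.

End QuotientGroup.

Section Balls.
Variables (G : groupType) (S : set G).

(** Balls around the identity, in the group itself: all statements about the
    quotients below are uniform because they refer to these finite sets. *)
Definition ball_word n : set G :=
  [set g | exists w, [/\ word S w, (size w <= n)%N & g = (\prod_(x <- w) x)%g]].

Lemma ball_word_le m n : (m <= n)%N -> ball_word m `<=` ball_word n.
Proof. by move=> mn g [w [Sw wm gE]]; exists w; rewrite (leq_trans wm). Qed.

Hypotheses (finS : finite_set S) (genS : generates S).

Lemma finite_ball_word n : finite_set (ball_word n).
Proof.
have finSV : finite_set (S `|` [set x^-1%g | x in S]).
  by rewrite finite_setU; split=> //; exact: finite_image.
elim: n => [|n IH].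
  apply: (@sub_finite_set _ _ [set 1%g]); last exact: finite_set1.
  by move=> g [[|x w] [_ // _ ->]]; rewrite big_nil.
apply: (@sub_finite_set _ _ (ball_word n `|`
   [set (x.1 * x.2)%g | x in (S `|` [set x^-1%g | x in S]) `*` ball_word n])).
  move=> g [[|x w] [Sw wn ->]]; first by left; exists [::].
  right; exists (x, (\prod_(z <- w) z)%g); last by rewrite big_cons.
  split=> /=; last first.
    by exists w; split=> // z zw; apply: Sw; rewrite inE zw orbT.
  have [|xS|xS] := Sw x; [by rewrite inE eqxx| by left|right].
  by exists (x^-1)%g; rewrite ?invgK.
rewrite finite_setU; split=> //; apply: finite_image.
exact: finite_setX.
Qed.

Lemma finite_sub_ball_word E : finite_set E -> exists n, E `<=` ball_word n.
Proof.
move=> /finite_seqP[s ->]; elim: s => [|g s [n IH]]; first by exists 0%N.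
have [w Sw gE] := genS g; exists (maxn (size w) n) => h /=.
rewrite inE => /predU1P[->|/IH]; first by exists w; rewrite leq_maxl.
by apply: ball_word_le; exact: leq_maxr.
Qed.

End Balls.

Section WordMetric.
Variables (R : realType) (G : groupType) (S : set G).
Variable K : nat -> normalClosed G.
Implicit Types i : nat.

Let dist i : quotg (K i) -> quotg (K i) -> R := word_dist R (quot_gens S K i).

Let lengths_lb i x y : has_lbound [set ((size w)%:R : R) | w in
        [set w | word (quot_gens S K i) w /\ (x * \prod_(z <- w) z)%g = y]].
Proof. by exists 0 => _ [w _ <-]. Qed.

Let word_proj i w :
  word S w -> word (quot_gens S K i) (map (projg (K i)) w).
Proof.
by move=> Sw _ /mapP[z /Sw[zS|zS] ->]; [left; exists z|right; exists z^-1%g];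
  rewrite ?projgV.
Qed.

Lemma word_dist_ball i n (x : quotg (K i)) g :
  ball_word S n g -> dist x (x * projg (K i) g)%g <= n%:R.
Proof.
case=> w [Sw wn gE].
apply: (@le_trans _ _ (size w)%:R); last by rewrite ler_nat.
apply: ge_inf; first exact: lengths_lb.
exists (map (projg (K i)) w); last by rewrite size_map.
by split; [exact: word_proj|rewrite gE projg_prod].
Qed.

Lemma word_quot_gens i w : word (quot_gens S K i) w ->
  exists2 w', word S w' & map (projg (K i)) w' = w.
Proof.
elim: w => [|x w IH] Sw; first by exists [::].
have [|w' Sw' w'E] := IH; first by move=> z zw; apply: Sw; rewrite inE zw orbT.
have [z Sz zx] : exists2 z, S z \/ S z^-1%g & projg (K i) z = x.
  have [|[z zS zE]|[z zS zE]] := Sw x; first by rewrite inE eqxx.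
    by exists z; [left|].
  by exists z^-1%g; rewrite ?projgV ?zE ?invgK //; right.
exists (z :: w'); last by rewrite /= zx w'E.
by move=> t; rewrite inE => /predU1P[->|/Sw'].
Qed.

Hypothesis genS : generates S.

Lemma quotg_ball i (x y : quotg (K i)) :
  exists n, exists2 g, ball_word S n g & y = (x * projg (K i) g)%g.
Proof.
have [w Sw wE] := genS (repr (x^-1 * y)%g).
exists (size w), (repr (x^-1 * y)%g); first by exists w.
by rewrite projgK mulVKg.
Qed.

Let lengths_nonempty i x y : [set ((size w)%:R : R) | w in
    [set w | word (quot_gens S K i) w /\ (x * \prod_(z <- w) z)%g = y]] !=set0.
Proof.
have [m [g [w [Sw _ gE]] yE]] := quotg_ball x y.
exists (size (map (projg (K i)) w))%:R, (map (projg (K i)) w) => //.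
by split; [exact: word_proj|rewrite yE gE projg_prod].
Qed.

(** The infimum defining the word metric is attained, lengths being
    integers. *)
Lemma word_dist_le i n (x y : quotg (K i)) : dist x y <= n%:R ->
  exists2 g, ball_word S n g & y = (x * projg (K i) g)%g.
Proof.
move=> xyn; have : dist x y < n.+1%:R.
  by apply: le_lt_trans xyn _; rewrite ltr_nat.
rewrite /dist /word_dist => /(inf_lt (lengths_nonempty x y))[_ [w [Sw wE] <-]].
rewrite ltr_nat ltnS => wn; have [w' Sw' w'E] := word_quot_gens Sw.
exists (\prod_(z <- w') z)%g; last by rewrite projg_prod w'E wE.
by exists w'; rewrite -(size_map (projg (K i))) w'E.
Qed.

Lemma word_dist_ge0 i (x y : quotg (K i)) : 0 <= dist x y.
Proof. by apply: (lb_le_inf (lengths_nonempty x y)) => _ [w _ <-]. Qed.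

Lemma word_dist_bounded i : finite_set S -> finite_index (K i) ->
  exists n, forall x y : quotg (K i),
    exists2 g, ball_word S n g & y = (x * projg (K i) g)%g.
Proof.
move=> finS /finite_index_enum[e [_ eT]].
have [n En] := finite_sub_ball_word genS (finite_seq (map repr e)).
exists n => x y; exists (repr (x^-1 * y)%g); last by rewrite projgK mulVKg.
by apply: En; exact: map_f.
Qed.

End WordMetric.

(** * Uniform families of kernels on a sequence of quotients *)

Section UniformKernels.
Variables (R : realType) (G : groupType) (K : nat -> normalClosed G).

(** The upper and lower control of a coarse embedding, uniform in [i]. Bounded
    distance in a quotient is expressed by multiplication by an element of a
    fixed finite subset of [G], which makes no reference to generators. *)
Definition kernels_bounded (k : forall i, quotg (K i) -> quotg (K i) -> R) :=
  forall E : set G, finite_set E -> exists C, forall i x g, E g ->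
    k i x (x * projg (K i) g)%g <= C.

Definition kernels_proper (k : forall i, quotg (K i) -> quotg (K i) -> R) :=
  forall C, exists2 E : set G, finite_set E & forall i x y, k i x y < C ->
    exists2 g, E g & y = (x * projg (K i) g)%g.

Definition coarse_kernels :=
  exists k : forall i, quotg (K i) -> quotg (K i) -> R,
  [/\ forall i, euclidean (k i), kernels_bounded k & kernels_proper k].

(** The same information in bounded form: unit vectors attached to the points
    of every quotient, nearly constant along [E] and with inner product at
    most 1/2 for points that do not differ by an element of [E']. Unlike
    vectors of unbounded length, these can be averaged over sets that vary
    slightly. *)
Definition localized_kernels := forall (E : set G) (eps : R),
  finite_set E -> 0 < eps ->
  exists2 E' : set G, finite_set E' & forall i,
    exists u : quotg (K i) -> quotg (K i) -> R,
    [/\ gram u, forall x, u x x = 1, forall x y, 0 <= u x y,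
        forall x g, E g -> 1 - u x (x * projg (K i) g)%g <= eps &
        forall x y, 2^-1 < u x y ->
          exists2 g, E' g & y = (x * projg (K i) g)%g].

(** Cut off [t * k] for a scale [t] so small that [t * k] is at most [eps]
    along [E]; the kernel then drops to 1/2 where [k] reaches [4 / t]. *)
Lemma coarse_localized : (forall i, finite_index (K i)) ->
  coarse_kernels -> localized_kernels.
Proof.
move=> finK [k [ek bk pk]] E eps finE eps0.
have [C kC] := bk E finE.
pose t := eps / (`|C| + 1).
have C1 : 0 < `|C| + 1 by rewrite ltr_wpDl.
have t0 : 0 < t by rewrite divr_gt0.
have [E' finE' kE'] := pk (4 / t); exists E' => // i.
have [e [_ eT]] := finite_index_enum (finK i).
have [u [gu u1 u0 uk ub]] := gram_cutoff_euclidean eT (ek i) (ltW t0).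
exists u; split=> // [x g Eg|x y uxy].
  apply: le_trans (uk _ _) _; rewrite /t mulrAC ler_pdivrMr // ler_pM2l //.
  by rewrite (le_trans (kC i x g Eg)) // (le_trans (ler_norm C)) // lerDl.
apply: kE'; rewrite ltr_pdivlMr // mulrC ltNge; apply/negP => k4.
have := ub x y; rewrite leNgt => /negP; apply.
have : 2 <= 1 + t * k i x y / 4 by move: (t * _) k4 => z; lra.
have := u0 x y; move: uxy; move: (u x y) (1 + _) => a b; nra.
Qed.

Lemma sum_ltn_le (L m : nat) : \sum_(n < L) (n < m)%:R <= m%:R :> R.
Proof.
apply: (@le_trans _ _ (minn L m)%:R); last by rewrite ler_nat geq_minr.
elim: L => [|L IH]; first by rewrite big_ord0 min0n.
rewrite big_ord_recr /=; apply: le_trans (lerD IH (lexx _)) _.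
by rewrite -natrD ler_nat /minn; case: ltnP => h1; case: ltnP => h2; lia.
Qed.

Lemma sum_half_le (L : nat) : \sum_(n < L) 2^-1 ^+ n <= 2 :> R.
Proof.
suff -> : \sum_(n < L) 2^-1 ^+ n = 2 - 2 * 2^-1 ^+ L :> R.
  by rewrite lerBlDr lerDl mulr_ge0 // exprn_ge0 // invr_ge0.
elim: L => [|L IH]; first by rewrite big_ord0 expr0; ring.
by rewrite big_ord_recr /= IH exprSr; field.
Qed.

(** For each [n] take localized kernels [u n] that deviate from 1 by at most
    [2^-n] along the ball of radius [n], and add up the squared distances
    [2 * (1 - u n)]. Along the ball of radius [m] all but the first [m] terms
    are summable; points far away at the first [m] scales receive at least
    [m]. The finite quotient [i] is itself a ball of radius [L i], so that
    [L i] terms suffice there and the sum stays of finite rank. *)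
Lemma localized_coarse (S : set G) : finite_set S -> generates S ->
  (forall i, finite_index (K i)) -> localized_kernels -> coarse_kernels.
Proof.
move=> finS genS finK loc.
have half0 n : 0 < 2^-1 ^+ n :> R by rewrite exprn_gt0 // invr_gt0.
have {}loc n := cid2 (loc _ _ (finite_ball_word finS n) (half0 n)).
pose E' n : set G := s2val (loc n).
have finE' n : finite_set (E' n) := s2valP (loc n).
pose u n i := sval (cid (s2valP' (loc n) i)).
have gu n i : gram (u n i) by rewrite /u; case: (cid _) => ? [].
have u1 n i x : u n i x x = 1 by rewrite /u; case: (cid _) => ? [].
have u0 n i x y : 0 <= u n i x y by rewrite /u; case: (cid _) => ? [].
have u_close n i x g : ball_word S n g ->
    1 - u n i x (x * projg (K i) g)%g <= 2^-1 ^+ n.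
  by move: g; rewrite /u; case: (cid _) => ? [? ? ? H ?] ?; exact: H.
have u_far n i x y : 2^-1 < u n i x y ->
    exists2 g, E' n g & y = (x * projg (K i) g)%g.
  by rewrite /u; case: (cid _) => ? [? ? ? ? H]; exact: H.
pose k n i x y : R := 2 * (1 - u n i x y).
have ek n i : euclidean (k n i) by apply: euclidean_gram; [exact: gu|exact: u1].
have [L Lball] := choice (fun i => word_dist_bounded genS finS (finK i)).
exists (fun i x y => \sum_(n < L i) k n i x y); split.
- by move=> i; apply: (@euclidean_sum R _ _ _ (fun (n : 'I_(L i)) => k n i)).
- move=> E finE; have [m Em] := finite_sub_ball_word genS finE.
  exists (2 * m%:R + 4) => i x g Eg.
  apply: (@le_trans _ _ (\sum_(n < L i) (2 * (n < m)%:R + 2 * 2^-1 ^+ n))).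
    apply: ler_sum => n _; rewrite /k -mulrDr ler_pM2l //.
    have [nm|mn] := ltnP n m.
      rewrite /=; have := u0 n i x (x * projg (K i) g)%g; have := half0 n.
      by move: (2^-1 ^+ n) (u n i _ _) => a b /=; lra.
    rewrite add0r; apply: u_close; apply: (ball_word_le mn); exact: Em.
  rewrite big_split /= -!mulr_sumr lerD //.
    by rewrite ler_pM2l // sum_ltn_le.
  have := sum_half_le (L i); lra.
move=> C; pose m := Num.bound `|C|.
exists (ball_word S m `|` \bigcup_(n in `I_m) E' n).
  rewrite finite_setU; split; first exact: finite_ball_word.
  by apply: bigcup_finite => // n _; exact: finE'.
move=> i x y kC.
have [[n nm un]|no] := pselect (exists2 n, (n < m)%N & 2^-1 < u n i x y).
  by have [g E'g ->] := u_far n i x y un; exists g => //; right; exists n.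
have [Lm|mL] := leqP (L i) m.
  have [g gL ->] := Lball i x y; exists g => //.
  by left; exact: (ball_word_le Lm).
suff : m%:R <= \sum_(n < L i) k n i x y.
  have Cm : C < m%:R by apply: le_lt_trans (ler_norm _) _; exact: archi_boundP.
  by move=> /(lt_le_trans Cm) /(lt_trans kC); rewrite ltxx.
apply: (@le_trans _ _ (\sum_(n < L i) (n < m)%:R)).
  rewrite -(subnKC (ltnW mL)) big_split_ord /=.
  rewrite [X in _ <= X + _](eq_bigr (fun _ => 1)).
    rewrite sumr_const card_ord -[leLHS]addr0 lerD // sumr_ge0 //.
  by move=> n _; rewrite ltn_ord.
apply: ler_sum => n _; case: ltnP => nm /=; last exact: euclidean_ge0.
have : ~ (2^-1 < u n i x y) by move=> un; apply: no; exists n.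
by rewrite /k; move/negP; rewrite -leNgt; lra.
Qed.

End UniformKernels.

(** * Normal subgroups of finite index *)

Section NormalSubgroups.
Variable G : groupType.

Lemma normal_closedP (P : pred G) : P 1%g ->
  (forall x y, P x -> P y -> P (x * y)%g) -> (forall x, P x -> P x^-1%g) ->
  (forall x y, P x -> P (x ^ y)%g) ->
  exists N : normalClosed G, forall x, (x \in N) = P x.
Proof.
move=> P1 PM PV PJ.
pose N : normalClosed G := HB.pack (P : {pred G})
  (isMul1Closed.Build G P P1) (isMulClosed.Build G P PM)
  (isInvClosed.Build G P PV) (isConjClosed.Build G P PJ).
by exists N.
Qed.

Lemma finite_indexP (N : normalClosed G) (Y : Type) (f : G -> Y) :
  finite_set (range f) -> (forall x y, f x = f y -> (x^-1 * y)%g \in N) ->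
  finite_index N.
Proof.
move=> finf fN.
pose g y := if pselect (exists x, f x = y) is left ex
  then projg N (projT1 (cid ex)) else 1%g.
apply: (sub_finite_set (B := g @` range f)); last exact: finite_image.
move=> z _; exists (f (repr z)); first by exists (repr z).
rewrite /g; case: pselect => [ex|[]]; last by exists (repr z).
by case: cid => x /= xz; rewrite -[RHS]projgK; apply/projgP/fN.
Qed.

Lemma finite_index_all (I : Type) (A : I -> normalClosed G) (s : seq I) :
  (forall i, finite_index (A i)) ->
  exists2 N : normalClosed G, finite_index N &
    forall x, (x \in N) = all (fun i => x \in A i) s.
Proof.
move=> finA; elim: s => [|i s [N finN NE]].
  have [N NE] := @normal_closedP predT isT (fun _ _ _ _ => isT)
    (fun _ _ => isT) (fun _ _ _ => isT).
  exists N => //; apply: (@finite_indexP _ _ (fun=> tt)).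
    by apply: (sub_finite_set (B := [set tt])) => [[]|] //; exact: finite_set1.
  by move=> x y _; rewrite NE.
have [||||N' N'E] := @normal_closedP (fun x => (x \in A i) && (x \in N)).
- by rewrite !gpred1.
- by move=> x y /andP[xA xN] /andP[yA yN]; rewrite !gpredM.
- by move=> x /andP[xA xN]; rewrite !gpredVr.
- by move=> x y /andP[xA xN]; rewrite !Defs.gpredJ.
exists N' => [|x]; last by rewrite N'E NE.
apply: (@finite_indexP _ _ (fun x => (projg (A i) x, projg N x))).
  apply: sub_finite_set (finite_setX (finA i) finN).
  by move=> [a b].
by move=> x y [/projgP xyA /projgP xyN]; rewrite N'E xyA.
Qed.

Lemma residually_finite_seq (s : seq G) : residually_finite G ->
  exists2 N : normalClosed G, finite_index N &
    forall g, g \in s -> g \in N -> g = 1%g.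
Proof.
move=> rfG.
have sep g : exists N : normalClosed G,
    finite_index N /\ (g != 1%g -> g \notin N).
  have [->|/rfG[N finN gN]] := eqVneq g 1%g; last by exists N.
  have [|N finN _] := @finite_index_all False (fun f => match f with end) [::].
    by case.
  by exists N.
have [A AP] := choice sep.
have [N finN NE] := finite_index_all s (fun g => (AP g).1).
exists N => // g gs; rewrite NE => /allP/(_ g gs) gA; apply/eqP.
by apply: contraTT gA => /(AP g).2.
Qed.

Lemma finite_index_nested (A : nat -> normalClosed G) :
  (forall i, finite_index (A i)) ->
  exists M : nat -> normalClosed G, [/\ forall i, finite_index (M i),
    forall i, {subset M i.+1 <= M i} & forall i, {subset M i <= A i}].
Proof.
move=> finA.
have inter i : exists N : normalClosed G, finite_index N /\
    forall x, (x \in N) = all (fun j => x \in A j) (iota 0 i.+1).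
  by have [N finN NE] := finite_index_all (iota 0 i.+1) finA; exists N.
have [M MP] := choice inter; exists M; split=> [i|i x|i x].
- by case: (MP i).
- rewrite (MP i).2 (MP i.+1).2 => /allP xA; apply/allP => j ji; apply: xA.
  by move: ji; rewrite !mem_iota /= !add0n => /leq_trans; apply.
- by rewrite (MP i).2 => /allP; apply; rewrite mem_iota /= add0n ltnSn.
Qed.

End NormalSubgroups.

(** * Normal subgroups of a semidirect product *)

Section ActionKernel.
Variables (G H : groupType) (phi : group_action G H).

Lemma gactK g : cancel (phi g) (phi g^-1%g).
Proof. by move=> h; rewrite -gactM mulVg gact1. Qed.

Lemma gactVK g : cancel (phi g^-1%g) (phi g).
Proof. by move=> h; rewrite -gactM mulgV gact1. Qed.

Lemma gactV g h : phi g h^-1%g = (phi g h)^-1%g.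
Proof. by apply: (mulgI (phi g h)); rewrite -gmulfM !mulgV gact_one. Qed.

Lemma characteristic_gact (N : normalClosed H) : characteristic N ->
  forall g h, h \in N -> phi g h \in N.
Proof.
move=> charN g h hN.
have : (phi g @` [set` N]) (phi g h) by exists h.
by rewrite charN //; exists (phi g^-1%g); [exact: gactK|exact: gactVK].
Qed.

(** The subgroup of [G] acting trivially on the finite quotient by [N]: it has
    finite index because its cosets are told apart by the self-maps that they
    induce on a finite set. *)
Lemma action_kernel (N : normalClosed H) : finite_index N ->
  (forall g h, h \in N -> phi g h \in N) ->
  exists2 C : normalClosed G, finite_index C &
    forall g, g \in C -> forall h, (h^-1 * phi g h)%g \in N.
Proof.
move=> finN invN.
pose triv g := forall h, (h^-1 * phi g h)%g \in N.
have trivP g : triv g <-> forall h, projg N (phi g h) = projg N h.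
  by split=> t h; [apply/esym/projgP|apply/projgP/esym].
have act_proj g h h' : projg N h = projg N h' ->
    projg N (phi g h) = projg N (phi g h').
  by move=> /projgP hh'; apply/projgP; rewrite -gactV -gmulfM; exact: invN.
have [||||C CE] := @normal_closedP G (fun g => `[< triv g >]).
- by apply/asboolP/trivP => h; rewrite gact1.
- move=> x y /asboolP/trivP tx /asboolP/trivP ty; apply/asboolP/trivP => h.
  by rewrite gactM tx ty.
- move=> x /asboolP/trivP tx; apply/asboolP/trivP => h.
  by rewrite -[in RHS](gactVK x h) tx.
- move=> x y /asboolP/trivP tx; apply/asboolP/trivP => h.
  rewrite /conjg !gactM (act_proj _ _ _ (tx _)).
  by rewrite gactK.
exists C; last by move=> g; rewrite CE => /asboolP.
have [e [_ eT]] := finite_index_enum finN.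
pose F g : {ffun seq_sub e -> seq_sub e} :=
  [ffun z : seq_sub e => SeqSub (eT (projg N (phi g (repr (ssval z)))))].
apply: (@finite_indexP _ _ _ F); first exact: finite_finset.
move=> g g' FE; rewrite CE; apply/asboolP/trivP => h.
have gg' : projg N (phi g h) = projg N (phi g' h).
  have hr : projg N h = projg N (repr (projg N h)) by rewrite projgK.
  have := congr1 (fun f : {ffun seq_sub e -> seq_sub e} =>
    f (SeqSub (eT (projg N h)))) FE.
  by rewrite !ffunE => /(congr1 (@ssval _ _)) /=; rewrite -!(act_proj _ _ _ hr).
by rewrite gactM -(act_proj _ _ _ gg') gactK.
Qed.

(** Normality uses the triviality of the action: the conjugate of [(n, m)] by
    [(h, 1)] has first component [n ^ h * (h^-1 * phi m h)]. *)
Lemma semidirect_subgroup (N : normalClosed H) (M : normalClosed G) :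
  finite_index N -> finite_index M ->
  (forall g h, h \in N -> phi g h \in N) ->
  (forall g, g \in M -> forall h, (h^-1 * phi g h)%g \in N) ->
  exists2 K : normalClosed (sdprod phi), finite_index K &
    forall x : sdprod phi, (x \in K) = (x.1 \in N) && (x.2 \in M).
Proof.
move=> finN finM invN actM.
have [||||K KE] := @normal_closedP (sdprod phi)
  (fun x => (x.1 \in N) && (x.2 \in M)).
- by rewrite !gpred1.
- move=> [h g] [h' g'] /= /andP[hN gM] /andP[h'N g'M].
  by rewrite gpredM ?invN // gpredM.
- move=> [h g] /= /andP[hN gM].
  by rewrite invN ?gpredVr.
- move=> [n m] [h g] /andP[/= nN mM].
  rewrite /conjg /= -gmulfM; apply/andP; split; last exact: (Defs.gpredJ m g).
  apply: invN; rewrite (_ : _ * _ = n ^ h * (h^-1 * phi m h))%g.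
    by rewrite gpredM ?actM // Defs.gpredJ.
  by rewrite /conjg !mulgA mulgK.
exists K => //.
apply: (@finite_indexP _ _ _
  (fun x : sdprod phi => (projg N x.1, projg M x.2))).
  by apply: sub_finite_set (finite_setX finN finM) => -[].
move=> [h g] [h' g'] [/= /projgP hN /projgP gM]; rewrite KE /= gM andbT.
by rewrite -gmulfM; exact: invN.
Qed.

End ActionKernel.

(** * Averaging over a Følner set *)

(** The inner product of two unit vectors [v] and [w] of [R^I], distorted by a
    factor [u z] at each coordinate. *)
Section AveragedKernel.
Variables (R : realType) (I : Type) (e : seq I) (v w u : I -> R).
Hypotheses (v0 : forall z, 0 <= v z) (w0 : forall z, 0 <= w z).
Hypotheses (v1 : \sum_(z <- e) v z ^+ 2 = 1) (w1 : \sum_(z <- e) w z ^+ 2 = 1).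

Let sum_sqrB :
  \sum_(z <- e) (v z - w z) ^+ 2 = 2 - 2 * \sum_(z <- e) v z * w z.
Proof.
transitivity (\sum_(z <- e) v z ^+ 2 + \sum_(z <- e) w z ^+ 2 -
  2 * \sum_(z <- e) v z * w z); last by rewrite v1 w1.
by rewrite mulr_sumr -big_split -sumrB; apply: eq_bigr => z _ /=; ring.
Qed.

Let sum_mul_le1 : \sum_(z <- e) v z * w z <= 1.
Proof.
have : 0 <= \sum_(z <- e) (v z - w z) ^+ 2.
  by apply: sumr_ge0 => z _; exact: sqr_ge0.
rewrite sum_sqrB; lra.
Qed.

(** For nonnegative numbers [(v - w)^2 <= |v^2 - w^2|]: the square roots of
    two probability distributions that are close in total variation are close
    as unit vectors. *)
Lemma averaged_close d : 0 <= d -> (forall z, v z != 0 -> 1 - u z <= d) ->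
  1 - \sum_(z <- e) v z * w z * u z <=
  d + 2^-1 * \sum_(z <- e) `|v z ^+ 2 - w z ^+ 2|.
Proof.
move=> d0 ud; set T := \sum_(z <- e) `|_|.
have vwT : \sum_(z <- e) (v z - w z) ^+ 2 <= T.
  apply: ler_sum => z _; rewrite subr_sqr normrM.
  rewrite -[X in X <= _](real_normK (num_real _)) expr2 ler_wpM2l //.
  rewrite [leRHS]ger0_norm ?addr_ge0 // (le_trans (ler_normB _ _)) //.
  by rewrite !ger0_norm.
have : \sum_(z <- e) v z * w z * (1 - u z) <= d * \sum_(z <- e) v z * w z.
  rewrite mulr_sumr; apply: ler_sum => z _; have [->|vz] := eqVneq (v z) 0.
    by rewrite !mul0r mulr0.
  by rewrite mulrC ler_wpM2r ?mulr_ge0 // ud.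
have -> : \sum_(z <- e) v z * w z * (1 - u z) =
   \sum_(z <- e) v z * w z - \sum_(z <- e) v z * w z * u z.
  by rewrite -sumrB; apply: eq_bigr => z _; ring.
have : d * \sum_(z <- e) v z * w z <= d by rewrite ler_piMr.
move: sum_sqrB vwT.
move: (\sum_(z <- e) (_ - _) ^+ 2) (\sum_(z <- e) v z * w z).
move: (\sum_(z <- e) _) => a b c; lra.
Qed.

Lemma averaged_far : 2^-1 < \sum_(z <- e) v z * w z * u z ->
  exists z, [/\ v z != 0, w z != 0 & 2^-1 < u z].
Proof.
move=> far; apply: contrapT => no.
have : \sum_(z <- e) v z * w z * u z <= 2^-1 * \sum_(z <- e) v z * w z.
  rewrite mulr_sumr; apply: ler_sum => z _.
  have [->|vz] := eqVneq (v z) 0; first by rewrite !mul0r mulr0.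
  have [->|wz] := eqVneq (w z) 0; first by rewrite mulr0 mul0r mulr0.
  rewrite [leRHS]mulrC ler_wpM2l ?mulr_ge0 // leNgt; apply/negP => uz.
  by apply: no; exists z.
move: sum_mul_le1; lra.
Qed.

End AveragedKernel.

Section Folner.
Variables (R : realType) (G : groupType) (M : normalClosed G).

Definition translate (s : G) (A : {fset G}) : {fset G} :=
  [fset (s * x)%g | x in A]%fset.

Variables (e : seq (quotg M)) (A : {fset G}).
Hypotheses (ue : uniq e) (eT : forall z, z \in e).

(** [fiber_count A q], divided by the cardinality of [A], is the distribution
    of the class of [q * a] for [a] uniform in [A]. Multiplicities are counted
    since [A] may fail to inject into the quotient. *)
Definition fiber_count (B : {fset G}) (q : G) (z : quotg M) : R :=
  \sum_(a <- B) (projg M (q * a)%g == z)%:R.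

Lemma sum_indicator (y : quotg M) : \sum_(z <- e) (y == z)%:R = 1 :> R.
Proof.
rewrite (bigD1_seq y) //= eqxx big1 ?addr0 // => z zy.
by rewrite eq_sym (negbTE zy).
Qed.

Lemma sum_fiber_count B q : \sum_(z <- e) fiber_count B q z = #|` B|%:R.
Proof.
rewrite exchange_big /= (eq_bigr (fun _ => 1)) => [|a _]; last first.
  exact: sum_indicator.
by rewrite -[in RHS](sum1_size B) natr_sum.
Qed.

Lemma fiber_count_ge0 B q z : 0 <= fiber_count B q z.
Proof. by apply: sumr_ge0 => a _; rewrite ler0n. Qed.

Lemma fiber_count_translate s q z :
  fiber_count A (q * s)%g z = fiber_count (translate s A) q z.
Proof.
rewrite /fiber_count /translate big_imfset /=; last first.
  by move=> x y _ _; exact: mulgI.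
by apply: eq_bigr => a _; rewrite mulgA.
Qed.

Lemma fiber_count_proj q q' z : projg M q = projg M q' ->
  fiber_count A q z = fiber_count A q' z.
Proof. by move=> qq'; apply: eq_bigr => a _; rewrite !projgM qq'. Qed.

Lemma fiber_countU B C q z : {in B, forall a, a \notin C} ->
  fiber_count (B `|` C)%fset q z = fiber_count B q z + fiber_count C q z.
Proof.
move=> BC; rewrite /fiber_count -big_cat; apply: perm_big; apply: uniq_perm.
- exact: fset_uniq.
- rewrite cat_uniq !fset_uniq andbT /=; apply/hasPn => a aC.
  by apply/negP => /BC; rewrite aC.
- by move=> a; rewrite mem_cat in_fsetU.
Qed.

Lemma fiber_countB B C q z :
  `|fiber_count B q z - fiber_count C q z| <=
  fiber_count ((C `\` B) `|` (B `\` C))%fset q z.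
Proof.
have split_count D D' : fiber_count D q z =
    fiber_count (D `&` D')%fset q z + fiber_count (D `\` D')%fset q z.
  rewrite -[in LHS](fsetID D' D) fiber_countU // => a.
  by rewrite in_fsetI in_fsetD => /andP[_ ->].
rewrite (split_count B C) (split_count C B) fsetIC opprD addrACA subrr add0r.
rewrite [leRHS]fiber_countU => [|a]; last by rewrite !in_fsetD => /andP[_ ->].
apply: le_trans (ler_normB _ _) _.
by rewrite !ger0_norm ?fiber_count_ge0 // addrC.
Qed.

End Folner.

Section SemidirectKernel.
Variables (R : realType) (G H : groupType) (phi : group_action G H).
Variables (N : normalClosed H) (M : normalClosed G).
Variable K : normalClosed (sdprod phi).
Hypotheses (invN : forall g h, h \in N -> phi g h \in N)
  (actM : forall g, g \in M -> forall h, (h^-1 * phi g h)%g \in N)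
  (KE : forall x : sdprod phi, (x \in K) = (x.1 \in N) && (x.2 \in M)).

Lemma projg_sdprodP (x y : sdprod phi) : projg K x = projg K y <->
  projg N x.1 = projg N y.1 /\ projg M x.2 = projg M y.2.
Proof.
case: x y => [h g] [h' g']; rewrite !projgP KE /= -gmulfM.
split=> [/andP[hN ->]|[hN ->]]; last by rewrite invN.
by split=> //; rewrite -[X in X \in N](gactVK phi g) invN.
Qed.

Lemma projg_gact g g' h h' : projg M g = projg M g' -> projg N h = projg N h' ->
  projg N (phi g h) = projg N (phi g' h').
Proof.
move=> /projgP gM /projgP hN; transitivity (projg N (phi g h')).
  by apply/projgP; rewrite -gactV -gmulfM invN.
apply/projgP; have := invN g (actM gM h'); rewrite gmulfM gactV -gactM.
by rewrite mulVKg.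
Qed.

(** Left multiplication by [(1, z)^-1] moves the coset over [z] to the fiber
    [H]; [twist z h] is the [H]-component of the image of [(h, q)]. The choice
    of a representative of [z] is harmless since [M] acts trivially modulo
    [N]. *)
Definition twist (z : quotg M) (h : H) : quotg N :=
  projg N (phi (repr z)^-1%g h).

(** If [z] is the class of [q * a], then [z^-1 * q] acts like [a^-1]: seen
    from [z], multiplication by [c] on the right moves the [H]-component by
    the bounded amount [phi a^-1 c.1]. *)
Lemma twist_mul (x y c : sdprod phi) (a : G) z :
  projg K y = projg K (x * c)%g -> projg M (x.2 * a)%g = z ->
  twist z y.1 = (twist z x.1 * projg N (phi a^-1 c.1))%g.
Proof.
move=> /projg_sdprodP[/= y1 _] xaz.
rewrite /twist -projgM (projg_gact erefl y1) gmulfM !projgM -gactM.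
congr (_ * _)%g.
apply: projg_gact => //; rewrite projgM projgV projgK -xaz -projgV -projgM.
by rewrite invgM mulgVK.
Qed.

(** Conversely, points that look close from a common [z] near both of them are
    close, the displacement being determined by [a], [a'] and [b]. *)
Lemma twist_inv (x y : sdprod phi) (a a' : G) (b : H) z :
  projg M (x.2 * a)%g = z -> projg M (y.2 * a')%g = z ->
  twist z y.1 = (twist z x.1 * projg N b)%g ->
  projg K y = projg K (x * (phi a b, a * a'^-1) : sdprod phi)%g.
Proof.
move=> xaz yaz; rewrite /twist -projgM.
move=> /(projg_gact (erefl (projg M (repr z)))).
rewrite gmulfM !gactVK => yE; apply/projg_sdprodP; split=> /=; last first.
  by rewrite mulgA projgM xaz -yaz -projgM mulgK.
rewrite yE !projgM -gactM; congr (_ * _)%g; apply: projg_gact => //.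
by rewrite projgK xaz.
Qed.

Variables (e : seq (quotg M)) (A : {fset G}).
Hypotheses (ue : uniq e) (eT : forall z, z \in e) (A0 : A != fset0).
Variable u : quotg N -> quotg N -> R.
Hypotheses (gu : gram u) (u1 : forall h, u h h = 1).
Hypothesis u0 : forall h h', 0 <= u h h'.

Let weight (q : G) (z : quotg M) : R :=
  Num.sqrt (fiber_count R A q z / #|` A|%:R).

Let card_gt0 : 0 < #|` A|%:R :> R.
Proof. by rewrite ltr0n cardfs_gt0. Qed.

Let weight_ge0 q z : 0 <= weight q z. Proof. exact: sqrtr_ge0. Qed.

Let weight_sqr q z : weight q z ^+ 2 = fiber_count R A q z / #|` A|%:R.
Proof. by rewrite sqr_sqrtr // divr_ge0 ?fiber_count_ge0 // ltW. Qed.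

Let weight_sum q : \sum_(z <- e) weight q z ^+ 2 = 1.
Proof.
rewrite (eq_bigr _ (fun z _ => weight_sqr q z)) -mulr_suml sum_fiber_count //.
by rewrite mulfV // gt_eqF.
Qed.

Let weight_fiber q z :
  weight q z != 0 -> exists2 a, a \in A & projg M (q * a)%g = z.
Proof.
move=> wz; apply: contrapT => no; move/negP: wz; apply.
rewrite /weight /fiber_count big_seq big1 ?mul0r ?sqrtr0 // => a aA.
by case: eqP => // qaz; case: no; exists a.
Qed.

(** The unit vectors over [H] behind [u] are copied to each coset [z], seen
    from there through [twist], and combined with weights [weight q]
    concentrated near the coset [q] of the point. *)
Definition folner_kernel (x y : quotg K) : R :=
  \sum_(z <- e) weight (repr x).2 z * weight (repr y).2 z *
    u (twist z (repr x).1) (twist z (repr y).1).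

Lemma folner_kernel_gram : gram folner_kernel.
Proof.
apply: gram_sum => z; apply: gramM.
  exact: (gram_rank1 (fun x : quotg K => weight (repr x).2 z)).
exact: (gram_comp (fun x : quotg K => twist z (repr x).1)).
Qed.

Lemma folner_kernel_diag x : folner_kernel x x = 1.
Proof.
by rewrite /folner_kernel -[RHS](weight_sum (repr x).2); apply: eq_bigr => z _;
  rewrite u1 mulr1.
Qed.

Lemma folner_kernel_ge0 x y : 0 <= folner_kernel x y.
Proof. by apply: sumr_ge0 => z _; rewrite !mulr_ge0. Qed.

Lemma folner_kernel_close (x : quotg K) (c : sdprod phi) (d d' : R) : 0 <= d ->
  (forall a h, a \in A -> 1 - u h (h * projg N (phi a^-1 c.1))%g <= d) ->
  #|` ((translate c.2 A `\` A) `|` (A `\` translate c.2 A))%fset|%:R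
    <= d' * #|` A|%:R ->
  1 - folner_kernel x (x * projg K c)%g <= d + 2^-1 * d'.
Proof.
move=> d0 ud Ad'; set y := (x * projg K c)%g.
have yK : projg K (repr y) = projg K (repr x * c)%g.
  by rewrite projgM !projgK.
have [_ /= y2] := (projg_sdprodP _ _).1 yK.
apply: le_trans (averaged_close (d := d) _ _ _ _ _ _) _ => //.
  move=> z /weight_fiber[a aA xaz].
  by rewrite (twist_mul yK xaz); exact: ud.
rewrite lerD2l ler_pM2l ?invr_gt0 //.
set D := (_ `|` _)%fset in Ad'.
apply: (@le_trans _ _
    (\sum_(z <- e) fiber_count R D (repr x).2 z / #|` A|%:R)).
  apply: ler_sum => z _; rewrite !weight_sqr -mulrBl normrM.
  rewrite [X in _ * X]ger0_norm.
    rewrite ler_pM2r ?invr_gt0 // (fiber_count_proj _ _ _ y2).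
    by rewrite fiber_count_translate; exact: fiber_countB.
  by rewrite invr_ge0 ltW.
by rewrite -mulr_suml sum_fiber_count // ler_pdivrMr.
Qed.

Lemma folner_kernel_far (x y : quotg K) (E : set H) :
  (forall h h', 2^-1 < u h h' -> exists2 b, E b & h' = (h * projg N b)%g) ->
  2^-1 < folner_kernel x y ->
  exists a a' b, [/\ a \in A, a' \in A, E b &
    y = (x * projg K ((phi a b, a * a'^-1) : sdprod phi))%g].
Proof.
move=> uE far.
have [//|//|z [/weight_fiber[a aA xaz] /weight_fiber[a' a'A yaz] uz]] :=
  averaged_far _ _ (weight_sum _) (weight_sum _) far.
have [b Eb yb] := uE _ _ uz.
exists a, a', b; split=> //.
by rewrite -[LHS]projgK -[x in RHS]projgK -projgM; exact: twist_inv yb.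
Qed.

End SemidirectKernel.

(** The order of choices matters: first a Følner set [A] for the
    [G]-components of [E]; then a kernel on the quotients of [H] that is
    nearly invariant along the finitely many displacements [phi a^-1 h] that
    [A] and [E] produce. *)
Lemma localized_semidirect (R : realType) (G H : groupType)
    (phi : group_action G H) (N : nat -> normalClosed H)
    (M : nat -> normalClosed G) (K : nat -> normalClosed (sdprod phi)) :
  (forall i g h, h \in N i -> phi g h \in N i) ->
  (forall i g, g \in M i -> forall h, (h^-1 * phi g h)%g \in N i) ->
  (forall i (x : sdprod phi), (x \in K i) = (x.1 \in N i) && (x.2 \in M i)) ->
  (forall i, finite_index (M i)) -> amenable R G ->
  localized_kernels R N -> localized_kernels R K.
Proof.
move=> invN actM KE finM amG loc E eps finE eps0.
have finE2 : finite_set [set x.2 | x in E] by exact: finite_image.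
have [A A0 Afol] := amG (fset_set [set x.2 | x in E]) eps eps0.
have finA : finite_set [set` A] by exact: finite_fset.
pose EH : set H := [set phi p.1^-1%g p.2.1 | p in [set` A] `*` E].
have finEH : finite_set EH by apply/finite_image/finite_setX.
have [EH' finEH' uP] := loc EH (eps / 2) finEH (divr_gt0 eps0 (ltr0n _ 2)).
exists [set ((phi p.1.1 p.2, p.1.1 * p.1.2^-1)%g : sdprod phi) |
  p in ([set` A] `*` [set` A]) `*` EH'].
  by apply: finite_image; apply: finite_setX => //; exact: finite_setX.
move=> i; have [u [gu u1 u0 u_close u_far]] := uP i.
have [e [ue eT]] := finite_index_enum (finM i).
exists (folner_kernel e A u); split.
- exact: folner_kernel_gram.
- exact: folner_kernel_diag.
- exact: folner_kernel_ge0.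
- move=> x c Ec; rewrite (splitr eps) [X in _ <= _ + X]mulrC.
  apply: (folner_kernel_close (invN i) (actM i) (KE i)) => //.
  + by rewrite divr_ge0 // ltW.
  + by move=> a h aA; apply: u_close; exists (a, c).
  + by apply: Afol; rewrite in_fset_set // inE; exists c.
- move=> x y /(folner_kernel_far (invN i) (actM i) (KE i) ue eT A0 u_far).
  move=> [a [a' [b [aA a'A Eb ->]]]].
  by exists (phi a b, a * a'^-1)%g => //; exists ((a, a'), b).
Qed.

(** * Coarse embeddings of box spaces *)

(** The control functions are the best possible ones, the extreme values of
    [e] where [d] is at most, respectively at least, [t]; the value [t] itself
    is thrown in so that both sets are nonempty and the supremum tends to
    infinity. *)
Lemma coarse_control (R : realType) (X : Type) (d e : X -> X -> R) :
  (forall x y, 0 <= d x y) -> (forall x y, 0 <= e x y) ->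
  (forall r, exists C, forall x y, d x y <= r -> e x y <= C) ->
  (forall C, exists r, forall x y, e x y <= C -> d x y <= r) ->
  exists rho_ rho' : R -> R, [/\ control rho_, control rho' &
    forall x y, rho_ (d x y) <= e x y <= rho' (d x y)].
Proof.
move=> d0 e0 bnd prop.
pose above t : set R := [set z | z = t \/ exists x y, t <= d x y /\ z = e x y].
pose below t : set R := [set z | z = t \/ exists x y, d x y <= t /\ z = e x y].
have above_n0 t : above t !=set0 by exists t; left.
have above_lb t : 0 <= t -> lbound (above t) 0.
  by move=> t0 z [->//|[x [y [_ ->]]]].
have below_n0 t : below t !=set0 by exists t; left.
have below_ub t : has_ubound (below t).
  have [C xC] := bnd t; exists (Num.max t C) => z [->|[x [y [dt ->]]]].
    by rewrite le_max lexx.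
  by rewrite le_max (xC x y dt) orbT.
exists (fun t => inf (above t)), (fun t => sup (below t)); split.
- split.
  + by move=> t t0; apply: lb_le_inf => //; exact: above_lb.
  + move=> s t s0 st; apply: lb_le_inf => // z.
    move=> [->|[x [y [td ->]]]].
      by apply: le_trans st; apply: ge_inf; [exists 0; exact: above_lb|left].
    apply: ge_inf; first by exists 0; exact: above_lb.
    by right; exists x, y; split=> //; exact: le_trans td.
  + apply/cvgryPge => A; have [r rA] := prop A.
    exists (Num.max A r); split; first exact: num_real.
    move=> t /=; rewrite gt_max => /andP[At rt]; apply: lb_le_inf => // z.
    move=> [->|[x [y [td ->]]]]; first exact: ltW.
    rewrite leNgt; apply/negP => /ltW/rA dr.
    by have := lt_le_trans rt (le_trans td dr); rewrite ltxx.
- split.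
  + by move=> t t0; apply: le_trans t0 _; apply: ub_le_sup => //; left.
  + move=> s t _ st; apply: ge_sup => // z [->|[x [y [ds ->]]]].
      by apply: le_trans st _; apply: ub_le_sup => //; left.
    apply: ub_le_sup => //; right; exists x, y; split=> //.
    exact: le_trans st.
  + apply/cvgryPge => A; exists A; split; first exact: num_real.
    by move=> t /= /ltW At; apply: le_trans At _; apply: ub_le_sup => //; left.
move=> x y; apply/andP; split; last first.
  by apply: ub_le_sup => //; right; exists x, y.
by apply: ge_inf; [exists 0; exact: above_lb|right; exists x, y].
Qed.

Section Boxes.
Variables (R : realType) (G : groupType) (S : set G).
Variable K : nat -> normalClosed G.
Hypotheses (finS : finite_set S) (genS : generates S)
  (finK : forall i, finite_index (K i)).
Variable delta : nat -> R.

Let dist i : quotg (K i) -> quotg (K i) -> R := word_dist R (quot_gens S K i).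

Lemma box_dist_same i (x y : quotg (K i)) :
  box_dist S K delta (existT _ i x) (existT _ i y) = dist x y.
Proof. by rewrite /box_dist /= eqxx tagged_asE. Qed.

(** Restrict the embedding to each component: only distances within a
    component enter. *)
Lemma embeds_coarse_kernels :
  embeds_coarsely_in_Hilbert (box_dist S K delta) -> coarse_kernels R K.
Proof.
move=> [V [F [rho_ [rho' [[_ _ rho_y] [_ rho'_mono _] Frho]]]]].
pose f i (x : quotg (K i)) : V := F (existT _ i x).
have frho i x y : rho_ (dist x y) <= `|f i x - f i y| <= rho' (dist x y).
  by have := Frho (existT _ i x) (existT _ i y); rewrite box_dist_same.
exists (fun i x y => `|f i x - f i y| ^+ 2); split.
- move=> i; have [e [_ eT]] := finite_index_enum (finK i).
  exact: (euclidean_hilbert _ eT).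
- move=> E finE; have [n En] := finite_sub_ball_word genS finE.
  exists (rho' n%:R ^+ 2) => i x g Eg.
  have /andP[_ up] := frho i x (x * projg (K i) g)%g.
  have le_rho : `|f i x - f i (x * projg (K i) g)%g| <= rho' n%:R.
    apply: le_trans up _; apply: rho'_mono; first exact: word_dist_ge0.
    exact: word_dist_ball (En _ Eg).
  by rewrite ler_sqr ?nnegrE ?(le_trans _ le_rho).
move=> C; move/cvgryPge: rho_y => /(_ (`|C| + 1))[r [_ rC]].
pose n := Num.bound `|r|; exists (ball_word S n); first exact: finite_ball_word.
move=> i x y kC; apply: (@word_dist_le R _ _ _ genS).
rewrite leNgt; apply/negP => nd.
have /andP[low _] := frho i x y.
have : `|C| + 1 <= `|f i x - f i y|.
  apply: le_trans low; apply: rC; apply: lt_trans nd.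
  by apply: le_lt_trans (ler_norm _) _; exact: archi_boundP.
have := ler_norm C; have := normr_ge0 C; move: kC.
by move: `|C| `|_ - _| => a b; nra.
Qed.

Hypothesis gap : box_gaps S K delta.

Lemma word_dist_diameter i (x y : quotg (K i)) :
  dist x y <= diameter R (quot_gens S K i).
Proof.
have [n xn] := word_dist_bounded genS finS (finK i).
apply: ub_le_sup; last by exists x => //; exists y.
exists n%:R => _ [a _ [b _ <-]]; have [g gn ->] := xn a b.
exact: word_dist_ball.
Qed.

Lemma diameter_ge0 i : 0 <= diameter R (quot_gens S K i).
Proof.
apply: le_trans (word_dist_diameter (1%g : quotg (K i)) 1%g).
exact: word_dist_ge0.
Qed.

Let gap_diam i : diameter R (quot_gens S K i) <= delta i /\
  diameter R (quot_gens S K i.+1) <= delta i.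
Proof. by have := gap i; rewrite gt_max => /andP[/ltW ? /ltW ?]. Qed.

Let delta_ge0 i : 0 <= delta i.
Proof. exact: le_trans (diameter_ge0 i) (gap_diam i).1. Qed.

Let spine i j : R := \sum_(minn i j <= k < maxn i j) delta k.

(** Gaps exceed the adjacent diameters, so the distance of points in distinct
    components [i] and [j] lies between [spine i j] and three times
    [spine i j]. *)
Let diam_spine i j : i != j -> diameter R (quot_gens S K i) <= spine i j.
Proof.
have sum_ge0 m n : 0 <= \sum_(m <= k < n) delta k by apply: sumr_ge0.
rewrite neq_ltn /spine /minn /maxn => /orP[ij|ji].
  rewrite ij big_ltn //; apply: le_trans (gap_diam i).1 _.
  by rewrite lerDl sum_ge0.
rewrite ltnNge (ltnW ji) /=; case: i ji => // i ji.
rewrite big_nat_recr //=; apply: le_trans (gap_diam i).2 _.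
by rewrite lerDr sum_ge0.
Qed.

Let spineC i j : spine i j = spine j i.
Proof. by rewrite /spine minnC maxnC. Qed.

Let pos i : R := \sum_(0 <= k < i) delta k.

Let pos_spine i j : `|pos i - pos j| = spine i j.
Proof.
wlog ij : i j / (i <= j)%N.
  move=> W; case/orP: (leq_total i j) => [/W//|/W]; rewrite spineC => <-.
  exact: distrC.
rewrite /spine (minn_idPl ij) (maxn_idPr ij) /pos.
rewrite (big_cat_nat (leq0n i) ij) //=.
rewrite opprD addrA subrr add0r normrN ger0_norm //.
exact: sumr_ge0.
Qed.

Lemma box_dist_diff i j (x : quotg (K i)) (y : quotg (K j)) : i != j ->
  box_dist S K delta (existT _ i x) (existT _ j y) =
  dist x 1%g + spine i j + dist 1%g y.
Proof. by move=> ij; rewrite /box_dist /= (negbTE ij). Qed.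

Section Embedding.
Variables (k : forall i, quotg (K i) -> quotg (K i) -> R)
  (cs : forall i, seq (quotg (K i) -> R)).
Arguments k {i}.
Hypothesis kE : forall i x y, @k i x y = \sum_(c <- cs i) (c x - c y) ^+ 2.

Let coord i l (x : quotg (K i)) : R := nth (fun=> 0) (cs i) l x.

Let k_coord i n (x y : quotg (K i)) : (size (cs i) <= n)%N ->
  k x y = \sum_(l < n) (coord l x - coord l y) ^+ 2.
Proof.
move=> sn; rewrite kE (big_nth (fun=> 0)) big_mkord.
rewrite -(subnKC sn) big_split_ord /= [X in _ + X]big1 ?addr0 //.
by move=> l _; rewrite /coord nth_default ?leq_addr // subrr expr0n.
Qed.

(** The identities of all components are placed on a line, along the first
    coordinate; all components use the same remaining coordinates, normalized
    to vanish at the identity, so that points in distinct components are no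
    farther from each other than their distances to the identities dictate. *)
Let vec i (x : quotg (K i)) (n : nat) : R :=
  if n is l.+1 then coord l x - coord l (1%g : quotg (K i)) else pos i.

Let sqsum_vec i j (x : quotg (K i)) (y : quotg (K j)) n :
  sqsum (fun l => vec x l - vec y l) n.+1 = spine i j ^+ 2 +
   \sum_(l < n) ((coord l x - coord l (1%g : quotg (K i))) -
                 (coord l y - coord l (1%g : quotg (K j)))) ^+ 2.
Proof.
by rewrite /sqsum big_ord_recl /= -pos_spine real_normK ?num_real.
Qed.

Let vecP i (x : quotg (K i)) : vec x \in @square_summable R.
Proof.
apply/square_summableP; exists (pos i ^+ 2 + k x 1%g) => n.
apply: (@le_trans _ _ (sqsum (vec x) (maxn n (size (cs i))).+1)).
  apply: sqsum_le; exact: leq_trans (leq_maxl _ _) (leqnSn _).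
by rewrite /sqsum big_ord_recl /= -(k_coord _ _ (leq_maxr _ _)).
Qed.

Let emb (a : box_space K) : l2 R := L2 (vecP (projT2 a)).

Let emb_same i (x y : quotg (K i)) :
  `|emb (existT _ i x) - emb (existT _ i y)| ^+ 2 = k x y.
Proof.
rewrite l2_normE (@l2dot_finite _ _ (size (cs i)).+1).
  rewrite sqsum_vec /spine minnn maxnn big_geq // expr0n add0r.
  rewrite (k_coord _ _ (leqnn _)); apply: eq_bigr => l _.
  by congr (_ ^+ 2); ring.
case=> // l sl; rewrite l2B /= /coord nth_default //; ring.
Qed.

Let emb_lower i j (x : quotg (K i)) (y : quotg (K j)) :
  spine i j <= `|emb (existT _ i x) - emb (existT _ j y)|.
Proof.
rewrite -pos_spine.
exact: (l2_norm_coord (emb (existT _ i x) - emb (existT _ j y)) 0%N).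
Qed.

Let emb_upper i j (x : quotg (K i)) (y : quotg (K j)) :
  `|emb (existT _ i x) - emb (existT _ j y)| ^+ 2 <=
  spine i j ^+ 2 + 2 * k x 1%g + 2 * k y 1%g.
Proof.
rewrite l2_normE; apply: l2dot_le => n.
pose m := maxn n (maxn (size (cs i)) (size (cs j))).
apply: (@le_trans _ _ (sqsum (emb (existT _ i x) - emb (existT _ j y)) m.+1)).
  by apply: sqsum_le; exact: leq_trans (leq_maxl _ _) (leqnSn _).
rewrite sqsum_vec -addrA lerD2l.
rewrite (@k_coord i m) ?(@k_coord j m); first last.
- by rewrite /m !leq_max leqnn !orbT.
- by rewrite /m !leq_max leqnn !orbT.
rewrite !mulr_sumr -big_split ler_sum // => l _ /=.
have := sqr_ge0 ((coord l x - coord l (1%g : quotg (K i))) +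
                 (coord l y - coord l (1%g : quotg (K j)))).
by lra.
Qed.

Lemma coarse_kernels_embed : (forall i x y, 0 <= @k i x y) ->
  (forall i x y, @k i x y = @k i y x) ->
  kernels_bounded (@k) -> kernels_proper (@k) ->
  embeds_coarsely_in_Hilbert (box_dist S K delta).
Proof.
move=> k0 kC kb kp; exists (l2_hilbert R), emb; apply: coarse_control.
- move=> [i x] [j y]; have [ij|ij] := eqVneq i j.
    by subst j; rewrite box_dist_same word_dist_ge0.
  by rewrite box_dist_diff // !addr_ge0 ?word_dist_ge0 // -pos_spine.
- by move=> a b; exact: normr_ge0.
- move=> r; pose n := Num.bound `|r|.
  have [C kC0] := kb (ball_word S n) (finite_ball_word finS n).
  have rn : r <= n%:R.
    by apply: le_trans (ler_norm _) _; rewrite ltW // archi_boundP.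
  exists (n%:R ^+ 2 + 4 * `|C| + 1) => [[i x] [j y]] dr.
  have {}dr := le_trans dr rn.
  suff : `|emb (existT _ i x) - emb (existT _ j y)| ^+ 2 <=
      n%:R ^+ 2 + 4 * `|C|.
    by move: `|emb _ - _| (_ + 4 * _) => a b; nra.
  have close l (z w : quotg (K l)) : dist z w <= n%:R -> k z w <= `|C|.
    move=> /(word_dist_le genS)[g gn ->].
    by apply: le_trans (kC0 _ _ _ gn) _; exact: ler_norm.
  have [ij|ij] := eqVneq i j.
    subst j; rewrite emb_same; apply: le_trans (close _ _ _ _) _.
      by move: dr; rewrite box_dist_same.
    by have := sqr_ge0 (n%:R : R); have := normr_ge0 C; lra.
  move: dr; rewrite box_dist_diff // => dr.
  have dx := word_dist_ge0 R genS x 1%g; have dy := word_dist_ge0 R genS 1%g y.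
  have s0 : 0 <= spine i j by rewrite -pos_spine.
  have kx : k x 1%g <= `|C| by apply: close; rewrite /dist; lra.
  have ky : k y 1%g <= `|C| by rewrite kC; apply: close; rewrite /dist; lra.
  apply: le_trans (emb_upper x y) _.
  have : spine i j ^+ 2 <= n%:R ^+ 2.
    by rewrite ler_sqr ?nnegrE //; rewrite /dist in dr; lra.
  lra.
move=> C; have [E finE Ek] := kp (`|C| ^+ 2 + 1).
have [n En] := finite_sub_ball_word genS finE.
exists (n%:R + 3 * `|C|) => [[i x] [j y]] eC.
have {}eC := le_trans eC (ler_norm C).
have [ij|ij] := eqVneq i j.
  subst j; have [|g Eg ->] := Ek i x y.
    rewrite -emb_same.
    apply: le_lt_trans (_ : _ <= `|C| ^+ 2) _; last by rewrite ltrDl.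
    by rewrite ler_sqr ?nnegrE.
  rewrite box_dist_same; apply: le_trans (word_dist_ball _ _ (En _ Eg)) _.
  by rewrite lerDl mulr_ge0.
rewrite box_dist_diff //.
have := le_trans (emb_lower x y) eC.
have := le_trans (word_dist_diameter x 1%g) (diam_spine ij).
move: ij; rewrite eq_sym => /diam_spine; rewrite spineC.
move=> /(le_trans (word_dist_diameter 1%g y)).
by have := ler0n R n; lra.
Qed.

End Embedding.

Lemma coarse_kernels_embeds :
  coarse_kernels R K -> embeds_coarsely_in_Hilbert (box_dist S K delta).
Proof.
move=> [k [ek kb kp]].
apply: (@coarse_kernels_embed k (fun i => sval (cid (ek i)))) => //.
- by move=> i; case: (cid _).
- by move=> i x y; exact: euclidean_ge0.
- by move=> i x y; exact: euclideanC.
Qed.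

End Boxes.

(** * The theorem *)

(** [K i] is [N i] extended by a subgroup [M i] of [G] that acts trivially on
    the quotient by [N i] and, by residual finiteness, meets the ball of
    radius [i] only in the identity. *)
Lemma semidirect_box_sequence (G H : groupType) (phi : group_action G H)
    (N : nat -> normalClosed H) :
  finitely_generated G -> residually_finite G ->
  (forall i, characteristic (N i)) -> box_sequence N ->
  exists (M : nat -> normalClosed G) (K : nat -> normalClosed (sdprod phi)),
  [/\ box_sequence K, forall i, finite_index (M i),
      forall i g, g \in M i -> forall h, (h^-1 * phi g h)%g \in N i &
      forall i (x : sdprod phi), (x \in K i) = (x.1 \in N i) && (x.2 \in M i)].
Proof.
move=> [S finS genS] rfG charN [finN nestN capN].
have invN i := characteristic_gact phi (charN i).
have small i : exists A : normalClosed G, [/\ finite_index A,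
    forall g, g \in A -> forall h, (h^-1 * phi g h)%g \in N i &
    forall g, ball_word S i g -> g \in A -> g = 1%g].
  have [C finC actC] := action_kernel (finN i) (invN i).
  have /finite_seqP[s sE] := finite_ball_word finS i.
  have [L finL L1] := residually_finite_seq s rfG.
  have [|A finA AE] :=
    @finite_index_all _ _ (fun b : bool => if b then C else L) [:: true; false].
    by case.
  exists A; split=> // g; first by rewrite AE /= => /andP[/actC].
  by rewrite sE AE /= andbT => gs /andP[_ /(L1 _ gs)].
have [A AP] := choice small.
have finA i : finite_index (A i) by case: (AP i).
have [M [finM nestM MA]] := finite_index_nested finA.
have actM i g : g \in M i -> forall h, (h^-1 * phi g h)%g \in N i.
  by move=> /MA; case: (AP i) => _ actA _; exact: actA.
have semi i : exists K : normalClosed (sdprod phi), finite_index K /\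
    forall x : sdprod phi, (x \in K) = (x.1 \in N i) && (x.2 \in M i).
  have [K finK KE] := semidirect_subgroup (finN i) (finM i) (invN i) (@actM i).
  by exists K.
have [K KP] := choice semi.
exists M, K; split=> [|||i]; [|exact: finM|exact: actM|exact: (KP i).2].
split=> [i|i x|]; first exact: (KP i).1.
  by rewrite (KP i).2 (KP i.+1).2 => /andP[/nestN-> /nestM->].
apply/seteqP; split=> [x xK|_ -> i _ /=]; last exact: gpred1.
have {}xK i : (x.1 \in N i) && (x.2 \in M i) by rewrite -(KP i).2; exact: xK.
have x1 : x.1 = 1%g.
  suff : (\bigcap_i [set` N i]) x.1 by rewrite capN.
  by move=> i _; have /andP[] := xK i.
have x2 : x.2 = 1%g.
  have [w Sw wE] := genS x.2; have /andP[_ /MA xA] := xK (size w).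
  by case: (AP (size w)) => _ _; apply=> //; exists w.
by rewrite /= [x]surjective_pairing x1 x2.
Qed.

Theorem theorem13 (R : realType) (G H : groupType) (phi : group_action G H)
    (fgG : finitely_generated G) (rfG : residually_finite G)
    (S : set H) (finS : finite_set S) (genS : generates S)
    (rfH : residually_finite H)
    (T : set (sdprod phi)) (finT : finite_set T) (genT : generates T)
    (amG : amenable R G)
    (N : nat -> normalClosed H) (charN : forall i, characteristic (N i))
    (seqN : box_sequence N)
    (delta : nat -> R) (gapN : box_gaps S N delta)
    (embN : embeds_coarsely_in_Hilbert (box_dist S N delta)) :
  exists2 K : nat -> normalClosed (sdprod phi), box_sequence K &
    forall epsilon : nat -> R, box_gaps T K epsilon ->
      embeds_coarsely_in_Hilbert (box_dist T K epsilon).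
Proof.
have [M [K [seqK finM actM KE]]] :=
  semidirect_box_sequence phi fgG rfG charN seqN.
have finN : forall i, finite_index (N i) by case: seqN.
have finK : forall i, finite_index (K i) by case: seqK.
exists K => // epsilon gapK.
apply: coarse_kernels_embeds => //.
apply: (localized_coarse finT genT finK).
have invN i := characteristic_gact phi (charN i).
apply: (localized_semidirect invN actM KE finM amG).
apply: (coarse_localized finN).
exact: (embeds_coarse_kernels finS genS finN embN).
Qed.
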